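(* Let $k\ge 1$, let $B_+^{(\ell_0)},\dots,B_+^{(\ell_{k-1})}$ be Bergman-like weighted shifts, and let $W_\beta\equiv\mathrm{shift}(\beta_0,\beta_1,\dots)$ be a subnormal weighted shift with $\beta_n<\beta_{n+1}$ for all $n\ge 0$. Let $\mathbf{T}\equiv(T_1,T_2)$ be the commuting $2$-variable weighted shift whose weight diagram has first $k$ rows (rows $0,\dots,k-1$) equal to $B_+^{(\ell_0)},\dots,B_+^{(\ell_{k-1})}$, all remaining rows equal to the (unweighted) unilateral shift $U_+$, and $0$-th column given by $W_\beta$; assume that $\mathbf{T}$ is hyponormal. Let $b^{(\ell_j)}:=\|B_+^{(\ell_j)}\|$ $(j=0,\dots,k-1)$ and $c:=\|W_\beta\|$. Then $$\sigma_T(\mathbf{T})=\left(\overline{\mathbb{D}}\times c\,\overline{\mathbb{D}}\right)\cup\left(b^{(\ell_0)}\,\overline{\mathbb{D}}\times\{0\}\right),$$ $$\sigma_{Te}(\mathbf{T})=\left(\overline{\mathbb{D}}\times c\,\mathbb{T}\right)\cup\left(\mathbb{T}\times c\,\overline{\mathbb{D}}\right)\cup\left(\left(b^{(\ell_0)}\mathbb{T}\cup\cdots\cup b^{(\ell_{k-1})}\mathbb{T}\right)\times\{0\}\right).$$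
   Context: A $2$-variable weighted shift with bounded positive weights $\alpha_{(i,j)},\beta_{(i,j)}$ ($(i,j)\in\mathbb{Z}_+^2$) is the pair $\mathbf{T}\equiv(T_1,T_2)$ of bounded operators on $\ell^2(\mathbb{Z}_+^2)$, with canonical orthonormal basis $\{e_{(i,j)}\}$, given by $T_1e_{(i,j)}=\alpha_{(i,j)}e_{(i+1,j)}$ and $T_2e_{(i,j)}=\beta_{(i,j)}e_{(i,j+1)}$; it is commuting iff $\beta_{(i+1,j)}\alpha_{(i,j)}=\alpha_{(i,j+1)}\beta_{(i,j)}$ for all $i,j$, so a commuting shift is determined by its rows and its $0$-th column. Its $j$-th row is $\mathrm{shift}(\alpha_{(0,j)},\alpha_{(1,j)},\dots)$ and its $0$-th column is $\mathrm{shift}(\beta_{(0,0)},\beta_{(0,1)},\dots)$, where $\mathrm{shift}(w_0,w_1,\dots)$ denotes the unilateral weighted shift $e_n\mapsto w_ne_{n+1}$ on $\ell^2(\mathbb{Z}_+)$. For an integer $\ell\ge 1$, the Bergman-like weighted shift is $B_+^{(\ell)}:=\mathrm{shift}\left(\left\{\sqrt{\ell-\frac{1}{n+2}}:n\ge 0\right\}\right)$; $U_+=\mathrm{shift}(1,1,\dots)$. An operator is subnormal if it is the restriction of a normal operator to an invariant subspace. The pair $\mathbf{T}$ is (jointly) hyponormal if the operator matrix $\begin{pmatrix}[T_1^*,T_1]&[T_2^*,T_1]\\ [T_1^*,T_2]&[T_2^*,T_2]\end{pmatrix}$ is positive semidefinite, where $[S,R]:=SR-RS$. $\sigma_T$ and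 $\sigma_{Te}$ denote the Taylor spectrum and the Taylor essential spectrum (the set of $\lambda\in\mathbb{C}^2$ such that the Koszul complex of $\mathbf{T}-\lambda$ is not exact, respectively not Fredholm). $\mathbb{D}$ is the open unit disk, $\overline{\mathbb{D}}$ its closure, $\mathbb{T}$ the unit circle. *)

(* Defs.v *)
From HB Require Import structures.
From mathcomp Require Import all_boot all_order all_algebra.
From mathcomp Require Import sesquilinear complex.
From mathcomp Require Import all_classical all_reals.
From mathcomp Require Import ereal topology normedtype numfun esum.
From mathcomp Require Import finmap ring lra.
Set Implicit Arguments.
Unset Strict Implicit.
Unset Printing Implicit Defensive.
Import Order.TTheory GRing.Theory Num.Theory Num.Def.
Import numFieldNormedType.Exports.
Import Normc.
Local Open Scope classical_set_scope.
Local Open Scope complex_scope.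
Local Open Scope ring_scope.

Section Modulus.
Variable R : realType.
Implicit Types z w : R[i].

Lemma norm_normc z : `|z| = (normc z)%:C. Proof. by []. Qed.

Lemma normc_ge0 z : 0 <= normc z.
Proof. by rewrite -lecR -norm_normc normr_ge0. Qed.

Lemma sqr_normcE z : normc z ^+ 2 = complex.Re z ^+ 2 + complex.Im z ^+ 2.
Proof. by case: z => a b /=; rewrite sqr_sqrtr// addr_ge0 ?sqr_ge0. Qed.

(* Summing this over coordinates, with a and b the norms of the two vectors,
   gives Minkowski's inequality. *)
Lemma sqr_normcD (a b : R) z w : 0 < a -> 0 < b ->
  normc (z + w) ^+ 2 <= (1 + b / a) * normc z ^+ 2 + (1 + a / b) * normc w ^+ 2.
Proof.
move=> a0 b0; apply: (@le_trans _ _ ((normc z + normc w) ^+ 2)).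
  by rewrite ler_sqr ?nnegrE ?addr_ge0 ?normc_ge0// le_normcD.
rewrite -subr_ge0; set u := normc z; set v := normc w.
have -> : (1 + b / a) * u ^+ 2 + (1 + a / b) * v ^+ 2 - (u + v) ^+ 2 =
  (b * u - a * v) ^+ 2 / (a * b) by field; rewrite !gt_eqF.
by rewrite divr_ge0 ?sqr_ge0// ltW// mulr_gt0.
Qed.
End Modulus.

Section RealSum.
Variables (R : realType) (I : choiceType).
Implicit Types (f g h : I -> R) (r : R).

Definition ssum f : \bar R := (\esum_(i in setT) (f i)%:E)%E.

Definition summabler f := (ssum (fun i => `|f i|%R) < +oo)%E.

(* Unconditional sum of an absolutely summable family, as the sum of its
   positive part minus the sum of its negative part. *)
Definition rsum f : R := fine (ssum f^\+) - fine (ssum f^\-).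

Lemma ssum_ge0 f : (forall i, 0 <= f i) -> (0 <= ssum f)%E.
Proof. by move=> f0; apply: esum_ge0 => i _; rewrite lee_fin. Qed.

Lemma le_ssum f g : (forall i, f i <= g i) -> (ssum f <= ssum g)%E.
Proof. by move=> fg; apply: le_esum => i _; rewrite lee_fin. Qed.

Lemma ssumD f g : (forall i, 0 <= f i) -> (forall i, 0 <= g i) ->
  ssum (fun i => f i + g i) = (ssum f + ssum g)%E.
Proof.
move=> f0 g0; rewrite -esumD; [|by move=> i _; rewrite lee_fin..].
by apply: eq_esum => i _.
Qed.

Lemma ssumZ r f : 0 <= r -> (forall i, 0 <= f i) ->
  ssum (fun i => r * f i) = (r%:E * ssum f)%E.
Proof.
move=> r0 f0; rewrite /ssum /esum -ereal_supZl//; last first.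
  apply/set0P; exists 0%E; exists set0; last by rewrite fsbig_set0.
  by split; [exact: finite_set0|exact: sub0set].
rewrite image_comp; congr ereal_sup; apply: eq_imagel => A [finA _] /=.
by rewrite ge0_mule_fsumr// => i; rewrite lee_fin.
Qed.

Lemma ssum_finite (J : set I) f : finite_set J -> (forall i, 0 <= f i) ->
  (forall i, ~ J i -> f i = 0) -> ssum f = (\sum_(i \in J) (f i)%:E)%E.
Proof.
move=> finJ f0 fJ; rewrite -esum_fset//; last by move=> i _; rewrite lee_fin.
rewrite [RHS]esum_mkcond; apply: eq_esum => i _.
case: ifPn => // /negP iJ; rewrite fJ// => Ji; apply: iJ; exact/mem_set.
Qed.

Lemma ssum_fin_num f : (forall i, 0 <= f i) -> (ssum f < +oo)%E ->
  ssum f \is a fin_num.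
Proof. by move=> f0 foo; rewrite ge0_fin_numE// ssum_ge0. Qed.

Lemma ssumlt f g : (forall i, f i <= g i) -> (ssum g < +oo)%E ->
  (ssum f < +oo)%E.
Proof. by move=> fg; apply: le_lt_trans; exact: le_ssum. Qed.

Let posnegE f i : f i = f^\+ i - f^\- i.
Proof. by rewrite -[in LHS](funrposBneg f). Qed.

Lemma rsumB f g h : (forall i, 0 <= g i) -> (forall i, 0 <= h i) ->
  (ssum g < +oo)%E -> (ssum h < +oo)%E -> (forall i, f i = g i - h i) ->
  rsum f = fine (ssum g) - fine (ssum h).
Proof.
move=> g0 h0 gs hs fE.
have fp : (ssum f^\+%R < +oo)%E.
  apply: ssumlt gs => i; rewrite /funrpos fE ge_max g0 andbT.
  by rewrite gerBl.
have fn : (ssum f^\-%R < +oo)%E.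
  apply: ssumlt hs => i; rewrite /funrneg fE ge_max h0 andbT.
  by rewrite opprB gerBl.
have p0 i : 0 <= f^\+ i by rewrite funrpos_ge0.
have n0 i : 0 <= f^\- i by rewrite funrneg_ge0.
suff: (ssum f^\+%R + ssum h = ssum g + ssum f^\-%R)%E.
  move/(congr1 fine); rewrite !fineD ?ssum_fin_num// /rsum => /eqP.
  by rewrite -subr_eq => /eqP H; lra.
rewrite -!ssumD//; congr ssum; apply/funext => i.
have := posnegE f i; rewrite fE => H.
lra.
Qed.

Lemma rsum_ge0 f : (forall i, 0 <= f i) -> rsum f = fine (ssum f).
Proof.
move=> f0; rewrite /rsum (_ : f^\+ = f); last first.
  by apply/funext => i; rewrite /funrpos max_l.
rewrite (_ : f^\- = fun=> 0); last first.
  by apply/funext => i; rewrite /funrneg max_r// oppr_le0.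
by rewrite [X in _ - fine X]esum1// subr0.
Qed.

Lemma summabler_pos f : summabler f -> (ssum f^\+%R < +oo)%E.
Proof.
by apply: ssumlt => i; rewrite /funrpos ge_max normr_ge0 ler_norm.
Qed.

Lemma summabler_neg f : summabler f -> (ssum f^\-%R < +oo)%E.
Proof.
apply: ssumlt => i.
by rewrite /funrneg ge_max normr_ge0 -normrN ler_norm.
Qed.

Lemma rsumD f g : summabler f -> summabler g ->
  rsum (fun i => f i + g i) = rsum f + rsum g.
Proof.
move=> fs gs.
have P k i : 0 <= (k : I -> R)^\+ i by rewrite funrpos_ge0.
have N k i : 0 <= (k : I -> R)^\- i by rewrite funrneg_ge0.
have [fp fn] := (summabler_pos fs, summabler_neg fs).
have [gp gn] := (summabler_pos gs, summabler_neg gs).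
rewrite (@rsumB _ (fun i => f^\+ i + g^\+ i) (fun i => f^\- i + g^\- i)).
- rewrite !ssumD// !fineD ?ssum_fin_num//.
  by rewrite /rsum opprD addrACA.
- by move=> i; rewrite addr_ge0.
- by move=> i; rewrite addr_ge0.
- by rewrite ssumD// lte_add_pinfty.
- by rewrite ssumD// lte_add_pinfty.
move=> i; rewrite (posnegE f i) (posnegE g i) /=; lra.
Qed.

Lemma rsumN f : rsum (fun i => - f i) = - rsum f.
Proof. by rewrite /rsum opprB (funrposN f) (funrnegN f). Qed.

Lemma rsumZ r f : summabler f -> rsum (fun i => r * f i) = r * rsum f.
Proof.
move=> fs; wlog r0 : r / 0 <= r.
  move=> H; have [|r0] := leP 0 r; first exact: H.
  rewrite -[r]opprK mulNr -H ?oppr_ge0 ?ltW// -rsumN.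
  by congr rsum; apply/funext => i; rewrite mulNr.
have P i : 0 <= f^\+ i by rewrite funrpos_ge0.
have N i : 0 <= f^\- i by rewrite funrneg_ge0.
have [fp fn] := (summabler_pos fs, summabler_neg fs).
rewrite (@rsumB _ (fun i => r * f^\+ i) (fun i => r * f^\- i)).
- by rewrite !ssumZ// !fineM ?ssum_fin_num// -mulrBr.
- by move=> i; rewrite mulr_ge0.
- by move=> i; rewrite mulr_ge0.
- by rewrite ssumZ// lte_mul_pinfty ?lee_fin.
- by rewrite ssumZ// lte_mul_pinfty ?lee_fin.
by move=> i; rewrite {1}posnegE mulrBr.
Qed.
End RealSum.

Section ComplexSum.
Variables (R : realType) (I : choiceType).
Implicit Types (f g : I -> R[i]).

Definition csum f : R[i] :=
  rsum (fun i => complex.Re (f i)) +i* rsum (fun i => complex.Im (f i)).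

Definition summablec f := (ssum (fun i => normc (f i)) < +oo)%E.

Lemma summablec_Re f : summablec f -> summabler (fun i => complex.Re (f i)).
Proof.
by apply: ssumlt => i; rewrite -lecR -[leRHS]/(`|f i|) normc_ge_Re.
Qed.

Lemma summablec_Im f : summablec f -> summabler (fun i => complex.Im (f i)).
Proof.
apply: ssumlt => i; case: (f i) => a b /=.
by rewrite -sqrtr_sqr ler_wsqrtr// lerDr sqr_ge0.
Qed.

Lemma csumD f g : summablec f -> summablec g ->
  csum (fun i => f i + g i) = csum f + csum g.
Proof.
move=> fs gs; rewrite /csum.
rewrite -[RHS]/((_ + _) +i* (_ + _)) -!rsumD;
  [|exact: summablec_Im|exact: summablec_Im
   |exact: summablec_Re|exact: summablec_Re].
by congr (_ +i* _); congr rsum; apply/funext => i; case: (f i); case: (g i).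
Qed.

Lemma csumZ (a : R[i]) f : summablec f ->
  csum (fun i => a * f i) = a * csum f.
Proof.
move=> fs; have fr := summablec_Re fs; have fi := summablec_Im fs.
case: a => a b; rewrite /csum -[RHS]/((_ - _) +i* (_ + _)).
have sZ (r : R) (h : I -> R) : summabler h -> summabler (fun i => r * h i).
  move=> hs; rewrite /summabler.
  rewrite (_ : (fun i => _) = (fun i => `|r| * `|h i|)); last first.
    by apply/funext => i; rewrite normrM.
  by rewrite ssumZ// lte_mul_pinfty ?lee_fin.
have sN (h : I -> R) : summabler h -> summabler (fun i => - h i).
  by apply: ssumlt => i; rewrite normrN.
rewrite -!rsumZ// -rsumN -!rsumD; [|by auto..].
by congr (_ +i* _); congr rsum; apply/funext => i; case: (f i).
Qed.

Lemma csum_conj f : csum (fun i => (f i)^*) = (csum f)^*.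
Proof.
rewrite /csum -[RHS]/(_ +i* - _) -rsumN.
by congr (_ +i* _); congr rsum; apply/funext => i; case: (f i).
Qed.
End ComplexSum.

Section Ell2Type.
Variables (R : realType) (I : choiceType).
Implicit Types x y : I -> R[i].

Definition sqsum x : \bar R := ssum (fun i => normc (x i) ^+ 2).

Definition square_summable : {pred I -> R[i]} := fun x => (sqsum x < +oo)%E.

Lemma sqsum_ge0 x : (0 <= sqsum x)%E.
Proof. by apply: ssum_ge0 => i; rewrite sqr_ge0. Qed.

Lemma sqsumZ (a : R[i]) x : sqsum (a *: x) = ((normc a ^+ 2)%:E * sqsum x)%E.
Proof.
rewrite -ssumZ ?sqr_ge0//; last by move=> i; rewrite sqr_ge0.
by congr ssum; apply/funext => i; rewrite normcM exprMn.
Qed.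

Lemma sqsumD (a b : R) x y : 0 < a -> 0 < b ->
  (sqsum (x + y)%R <= (1 + b / a)%:E * sqsum x + (1 + a / b)%:E * sqsum y)%E.
Proof.
move=> a0 b0.
have ab : 0 <= 1 + a / b by rewrite addr_ge0// divr_ge0// ltW.
have ba : 0 <= 1 + b / a by rewrite addr_ge0// divr_ge0// ltW.
have sq0 (z : I -> R[i]) i : 0 <= normc (z i) ^+ 2 by rewrite sqr_ge0.
rewrite /sqsum -!ssumZ// -ssumD//; last 2 first.
- by move=> i; rewrite mulr_ge0.
- by move=> i; rewrite mulr_ge0.
by apply: le_ssum => i; exact: sqr_normcD.
Qed.

Lemma square_summable_submod : submod_closed square_summable.
Proof.
split=> [|a x y xs ys]; rewrite unfold_in.
  rewrite /sqsum /ssum esum1 ?ltry// => i _.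
  by rewrite -[(0 : I -> R[i]) i]/(0%:C) normc0 expr0n.
apply: le_lt_trans (sqsumD _ _ ltr01 ltr01) _.
rewrite divr1 lte_add_pinfty// lte_mul_pinfty ?lee_fin ?addr_ge0//.
by rewrite sqsumZ lte_mul_pinfty ?lee_fin ?sqr_ge0.
Qed.

HB.instance Definition _ :=
  GRing.isSubmodClosed.Build R[i] (I -> R[i]) square_summable
    square_summable_submod.

Record ell2_type := Ell2 {
  ell2_fun :> I -> R[i];
  ell2_funP : ell2_fun \in square_summable }.

HB.instance Definition _ := [isSub for ell2_fun].
HB.instance Definition _ := [Choice of ell2_type by <:].
HB.instance Definition _ := [SubChoice_isSubLmodule of ell2_type by <:].

Implicit Types u v : ell2_type.

Definition ell2_norm u : R := Num.sqrt (fine (sqsum u)).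

Lemma sqsum_fin_num u : sqsum u \is a fin_num.
Proof. by rewrite ge0_fin_numE ?sqsum_ge0//; case: u. Qed.

Lemma sqr_ell2_norm u : ell2_norm u ^+ 2 = fine (sqsum u).
Proof. by rewrite sqr_sqrtr// fine_ge0// sqsum_ge0. Qed.

Lemma sqsum_normE u : sqsum u = (ell2_norm u ^+ 2)%:E.
Proof. by rewrite sqr_ell2_norm fineK// sqsum_fin_num. Qed.

Lemma ell2_norm_ge0 u : 0 <= ell2_norm u.
Proof. by rewrite sqrtr_ge0. Qed.

Lemma ell2_norm_coord u i : normc (u i) <= ell2_norm u.
Proof.
rewrite -ler_sqr ?nnegrE ?normc_ge0 ?ell2_norm_ge0// -lee_fin -sqsum_normE.
apply: esum_ge; exists [set i]; last by rewrite fsbig_set1.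
by split; [exact: finite_set1|exact: subsetT].
Qed.

Lemma ell2_normD u v : ell2_norm (u + v) <= ell2_norm u + ell2_norm v.
Proof.
have [u0|un0] := eqVneq (ell2_norm u) 0.
  have -> : u = 0.
    apply/val_inj/funext => i; apply: eq0_normc; apply/eqP.
    by rewrite eq_le normc_ge0 andbT (le_trans (ell2_norm_coord u i))// u0.
  by rewrite add0r lerDr ell2_norm_ge0.
have [v0|vn0] := eqVneq (ell2_norm v) 0.
  have -> : v = 0.
    apply/val_inj/funext => i; apply: eq0_normc; apply/eqP.
    by rewrite eq_le normc_ge0 andbT (le_trans (ell2_norm_coord v i))// v0.
  by rewrite addr0 lerDl ell2_norm_ge0.
have up : 0 < ell2_norm u by rewrite lt_def un0 ell2_norm_ge0.
have vp : 0 < ell2_norm v by rewrite lt_def vn0 ell2_norm_ge0.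
rewrite -ler_sqr ?nnegrE ?addr_ge0 ?ell2_norm_ge0// -lee_fin -sqsum_normE.
apply: le_trans (sqsumD _ _ up vp) _.
rewrite !sqsum_normE -!EFinM -EFinD lee_fin le_eqVlt; apply/orP; left.
by apply/eqP; field; rewrite un0 vn0.
Qed.

Lemma ell2_norm_eq0 u : ell2_norm u = 0 -> u = 0.
Proof.
move=> u0; apply/val_inj/funext => i; apply: eq0_normc; apply/eqP.
by rewrite eq_le normc_ge0 andbT (le_trans (ell2_norm_coord u i))// u0.
Qed.

Lemma ell2_normZ a u : ell2_norm (a *: u) = normc a * ell2_norm u.
Proof.
apply/eqP; rewrite -(@eqrXn2 _ 2)// ?mulr_ge0 ?normc_ge0 ?ell2_norm_ge0//.
rewrite exprMn sqr_ell2_norm -[ell2_fun _]/(a *: (u : I -> R[i])) sqsumZ.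
by rewrite sqsum_normE.
Qed.

Let ell2_normDC u v :
  (ell2_norm (u + v))%:C <= (ell2_norm u)%:C + (ell2_norm v)%:C.
Proof. by rewrite -raddfD lecR ell2_normD. Qed.

Let ell2_normZC (a : R[i]) u : (ell2_norm (a *: u))%:C = `|a| * (ell2_norm u)%:C.
Proof. by rewrite ell2_normZ norm_normc rmorphM. Qed.

Let ell2_norm_eq0C u : (ell2_norm u)%:C = 0 -> u = 0.
Proof. by move=> [/ell2_norm_eq0]. Qed.

HB.instance Definition _ := Lmodule_isNormed.Build R[i] ell2_type
  ell2_normDC ell2_normZC ell2_norm_eq0C.


Definition ell2_dot u v : R[i] := csum (fun i => u i * (v i)^*).

Lemma ell2_dot_summable u v : summablec (fun i => u i * (v i)^*).
Proof.
have sq0 (z : I -> R[i]) i : 0 <= normc (z i) ^+ 2 by rewrite sqr_ge0.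
apply: (@ssumlt _ _ _ (fun i => normc (u i) ^+ 2 + normc (v i) ^+ 2)).
  move=> i; rewrite normcM (_ : normc (v i)^* = normc (v i)); last first.
    by case: (v i) => a b /=; rewrite sqrrN.
  have := sqr_ge0 (normc (u i) - normc (v i)).
  have := mulr_ge0 (normc_ge0 (u i)) (normc_ge0 (v i)); nra.
by rewrite ssumD// lte_add_pinfty//; [case: u|case: v].
Qed.

Lemma ell2_dotC u v : ell2_dot u v = (-1) ^+ false * conjC (ell2_dot v u).
Proof.
rewrite expr0 mul1r -[conjC _]/(_^*) -csum_conj; congr csum.
by apply/funext => i; rewrite -[RHS]/(conjc _) rmorphM /= conjcK mulrC.
Qed.

Lemma ell2_dotP v : GRing.linear_for *%R (ell2_dot ^~ v).
Proof.
move=> a x y; rewrite /ell2_dot -csumZ; last exact: ell2_dot_summable.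
rewrite -csumD; last exact: ell2_dot_summable.
- by congr csum; apply/funext => i; rewrite mulrA -mulrDl.
- have := ell2_dot_summable (a *: x) v; rewrite /summablec.
  by under [in X in X -> _]eq_fun do rewrite -mulrA.
Qed.

Lemma ell2_dot_bilinear :
  bilinear_for (GRing.Scale.Law.clone _ _ *%R _)
    (GRing.Scale.Law.clone _ _ (conjC \; *%R) _) ell2_dot.
Proof.
split=> [v|u] a x y /=; first exact: ell2_dotP.
rewrite !(ell2_dotC u) expr0 !mul1r ell2_dotP.
by rewrite -[in LHS]/(_^*) rmorphD rmorphM.
Qed.

HB.instance Definition _ := bilinear_isBilinear.Build R[i]
  ell2_type ell2_type R[i] _ _ ell2_dot ell2_dot_bilinear.

HB.instance Definition _ := isHermitianSesquilinear.Build R[i] ell2_type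
  false conjC ell2_dot ell2_dotC.

Lemma ell2_dotE u : ell2_dot u u = `|u| ^+ 2.
Proof.
rewrite -[RHS]/((ell2_norm u)%:C ^+ 2) -rmorphXn /= sqr_ell2_norm.
rewrite /ell2_dot /csum; congr (_ +i* _).
  rewrite rsum_ge0; last by move=> i; case: (u i) => a b /=; nra.
  congr (fine (ssum _)); apply/funext => i; rewrite sqr_normcE.
  by case: (u i) => a b /=; rewrite mulrN opprK.
rewrite rsum_ge0; last by move=> i; case: (u i) => a b /=; rewrite mulrN mulrC addNr.
rewrite /ssum esum1// => i _.
by case: (u i) => a b /=; rewrite mulrN mulrC addNr.
Qed.

Let ell2_dot_gt0 u : u != 0 -> 0 < ell2_dot u u.
Proof. by move=> u0; rewrite ell2_dotE exprn_gt0// normr_gt0. Qed.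

HB.instance Definition _ := isDotProduct.Build R[i] ell2_type
  ell2_dot ell2_dot_gt0.

Lemma ell2_complete (F : set_system ell2_type) :
  ProperFilter F -> cauchy F -> cvg F.
Proof.
move=> FF /cauchyP Fc.
have Fe (e : R) : 0 < e -> exists w0, \forall u \near F, ell2_norm (u - w0) < e.
  move=> e0; have [|w0 Hw0] := Fc e%:C; first by rewrite ltcR.
  exists w0; near=> u.
  suff: `|w0 - u| < e%:C by rewrite distrC ltcR.
  by near: u; exact: Hw0.
have Fcoord (g : R[i] -> R) : (forall a b, `|g a - g b| <= normc (a - b)) ->
    forall i, cvg ((fun u : ell2_type => g (u i)) @ F).
  move=> gL i; apply/cauchy_cvgP/cauchyP => _/posnumP[e].
  have [w0 Hw0] := Fe e%:num ltac:(by []).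
  exists (g (w0 i)); apply: (filterS _ Hw0) => u uw0.
  suff: `|g (w0 i) - g (u i)| < e%:num by [].
  rewrite distrC; apply: le_lt_trans (gL _ _) _.
  exact: le_lt_trans (ell2_norm_coord (u - w0) i) uw0.
have gRe (a b : R[i]) : `|complex.Re a - complex.Re b| <= normc (a - b).
  case: a b => [a a'] [b b'] /=.
  by rewrite -sqrtr_sqr ler_wsqrtr// lerDl sqr_ge0.
have gIm (a b : R[i]) : `|complex.Im a - complex.Im b| <= normc (a - b).
  case: a b => [a a'] [b b'] /=.
  by rewrite -sqrtr_sqr ler_wsqrtr// lerDr sqr_ge0.
pose l i : R[i] := lim ((fun u : ell2_type => complex.Re (u i)) @ F) +i*
                   lim ((fun u : ell2_type => complex.Im (u i)) @ F).
have key (w0 : ell2_type) (e : R) : (\forall u \near F, ell2_norm (u - w0) < e) ->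
    (sqsum (l - (w0 : I -> R[i]))%R <= (e ^+ 2)%:E)%E.
  move=> Hw0; apply: ub_ereal_sup => _ [A [finA _] <-].
  rewrite fsbig_finite//= sumEFin lee_fin.
  pose h (u : ell2_type) := \sum_(i <- fset_set A) normc (u i - w0 i) ^+ 2.
  suff hl : h @ F --> \sum_(i <- fset_set A) normc (l i - w0 i) ^+ 2.
    apply: (cvgr_to_le hl); apply: filterS Hw0 => u uw0.
    apply: (@le_trans _ _ (ell2_norm (u - w0) ^+ 2)); last first.
      rewrite ler_sqr ?nnegrE ?ell2_norm_ge0// ?(ltW uw0)//.
      exact: le_trans (ell2_norm_ge0 _) (ltW uw0).
    rewrite -lee_fin -sqsum_normE; apply: esum_ge; exists A => //.
    by rewrite fsbig_finite//= sumEFin.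
  apply: cvg_big => [|i _]; first exact: add_continuous.
  have FF' : Filter F by exact: filter_filter.
  have cB g (b : R) : cvg ((fun u : ell2_type => g (u i)) @ F) ->
      ((fun u : ell2_type => (g (u i) - b) ^+ 2) @ F) -->
      (lim ((fun u : ell2_type => g (u i)) @ F) - b) ^+ 2.
    move=> cg; rewrite expr2.
    have cgb := @cvgB _ _ _ F FF' _ _ _ _ cg (@cvg_cst _ b _ F FF').
    have := @cvgM _ _ F FF' _ _ _ _ cgb cgb.
    by apply: cvg_trans; apply: near_eq_cvg; apply: nearW => u; rewrite expr2.
  have H := @cvgD _ _ _ F FF' _ _ _ _ (cB _ (complex.Re (w0 i)) (Fcoord _ gRe i))
                 (cB _ (complex.Im (w0 i)) (Fcoord _ gIm i)).
  have -> : normc (l i - w0 i) ^+ 2 =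
      (complex.Re (l i) - complex.Re (w0 i)) ^+ 2 +
      (complex.Im (l i) - complex.Im (w0 i)) ^+ 2.
    by rewrite sqr_normcE; case: (w0 i).
  rewrite (_ : (fun x : ell2_type => normc (x i - w0 i) ^+ 2) =
    (fun u : ell2_type => (complex.Re (u i) - complex.Re (w0 i)) ^+ 2) +
    (fun u : ell2_type => (complex.Im (u i) - complex.Im (w0 i)) ^+ 2))//.
  apply/funext => u; rewrite sqr_normcE.
  by rewrite -[RHS]/(_ ^+ 2 + _ ^+ 2); case: (u i) (w0 i) => [? ?] [? ?].
have [w1 Hw1] := Fe 1 ltr01.
have lP : l \in square_summable.
  have d1 : l - (w1 : I -> R[i]) \in square_summable.
    by rewrite unfold_in (le_lt_trans (key _ _ Hw1))// ltry.
  by rewrite -(subrK (w1 : I -> R[i]) l) rpredD//; case: (w1).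
apply/cvg_ex; exists (Ell2 lP); apply/cvgrPdist_lt => e e0.
have [r r0 ->] : exists2 r : R, 0 < r & e = r%:C.
  exists (complex.Re e); first by move: e0; rewrite ltcE => /andP[].
  by rewrite RRe_real// gtr0_real.
have r20 : 0 < r / 2 by rewrite divr_gt0.
have [w0 Hw0] := Fe _ r20.
have lw0 : ell2_norm (Ell2 lP - w0) <= r / 2.
  rewrite -ler_sqr ?nnegrE ?ell2_norm_ge0 ?(ltW r20)// -lee_fin -sqsum_normE.
  exact: key.
near=> u.
suff: ell2_norm (Ell2 lP - u) < r by rewrite -ltcR.
rewrite -[_ - u](subrKA w0) [r]splitr.
apply: le_lt_trans (ell2_normD _ _) _; apply: ler_ltD => //.
rewrite -ltcR -[(ell2_norm _)%:C]/(`|w0 - u|) distrC ltcR.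
by near: u.
Unshelve. all: by end_near. Qed.

HB.instance Definition _ := Uniform_isComplete.Build ell2_type ell2_complete.

Lemma ell2_delta_subproof (i : I) :
  (fun j => (j == i)%:R : R[i]) \in square_summable.
Proof.
have sq0 (j : I) : 0 <= normc ((j == i)%:R : R[i]) ^+ 2 by rewrite sqr_ge0.
rewrite unfold_in /sqsum (@ssum_finite _ _ [set i])//.
- by rewrite fsbig_set1 ltry.
- move=> j /eqP/negPf ji; rewrite ji -[(false%:R : R[i])]/(0%:C).
  by rewrite normc0 expr0n.
Qed.

Definition ell2_delta (i : I) : ell2_type := Ell2 (ell2_delta_subproof i).
End Ell2Type.

(* The inner product is linear in its first argument. *)
Record hilbertType (R : realType) := HilbertType {
  hilbert_sort :> completeNormedModType R[i];
  hdot : {dot hilbert_sort for @conjC R[i]};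
  hdotE : forall u, hdot u u = `|u| ^+ 2 }.

Local Notation "''[' u , v ]" := (hdot _ u v) : ring_scope.

Definition ell2 (R : realType) (I : choiceType) : hilbertType R :=
  @HilbertType R (ell2_type R I) (@ell2_dot R I) (@ell2_dotE R I).

Definition ell2_basis (R : realType) (I : choiceType) (i : I) : ell2 R I :=
  ell2_delta R i.

Section Operators.
Variables (R : realType) (H : hilbertType R).
Implicit Types (T S : {linear H -> H}).

Definition bounded_operator T : Prop :=
  exists M : R, forall u, `|T u| <= M%:C * `|u|.

Definition opnorm T : R :=
  sup [set r : R | exists2 u, `|u| <= 1 & `|T u| = r%:C].

Definition is_adjoint T S : Prop := forall u v, '[T u, v] = '[u, S v].

Definition commutator (A B : H -> H) (u : H) : H := A (B u) - B (A u).

Definition normal_operator T : Prop :=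
  exists2 S : {linear H -> H}, is_adjoint T S & forall u, S (T u) = T (S u).

(* Positivity on H + H of the operator matrix [A11, A12; A21, A22]; in R[i],
   0 <= z says that z is real and nonnegative. *)
Definition opmatrix_ge0 (A11 A12 A21 A22 : H -> H) : Prop :=
  forall u v, 0 <= '[A11 u + A12 v, u] + '[A21 u + A22 v, v].

Definition hyponormal_pair T1 T2 : Prop :=
  exists S1 S2 : {linear H -> H},
    [/\ is_adjoint T1 S1, is_adjoint T2 S2 &
        opmatrix_ge0 (commutator S1 T1) (commutator S2 T1)
                     (commutator S1 T2) (commutator S2 T2)].
End Operators.

(* The isometry V identifies H with a closed N-invariant subspace of K. *)
Definition subnormal (R : realType) (H : hilbertType R) (T : {linear H -> H}) :
  Prop :=
  exists (K : hilbertType R) (N : {linear K -> K}) (V : {linear H -> K}),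
    [/\ bounded_operator N, normal_operator N,
        forall u, `|V u| = `|u| & forall u, N (V u) = V (T u)].

Section Koszul.
Variables (R : realType) (H : lmodType R[i]).
Implicit Types (A : H -> H).

(* The Koszul complex 0 -> H -> H * H -> H -> 0 of the pair (A1, A2). *)
Definition koszul0 A1 A2 (u : H) : H * H := (A1 u, A2 u).

Definition koszul1 A1 A2 (p : H * H) : H := A1 p.2 - A2 p.1.

Definition koszul_exact A1 A2 : Prop :=
  [/\ [set u | koszul0 A1 A2 u = 0] = [set 0],
      [set p | koszul1 A1 A2 p = 0] = range (koszul0 A1 A2) &
      setT = range (koszul1 A1 A2)].

(* For subspaces B of Z: the quotient Z / B is finite-dimensional. *)
Definition fin_dim_quotient (V : lmodType R[i]) (Z B : set V) : Prop :=
  exists (n : nat) (v : 'I_n -> V), (forall i, Z (v i)) /\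
    forall z, Z z -> exists a : 'I_n -> R[i], B (z - \sum_(i < n) a i *: v i).

(* All homology spaces are finite-dimensional; for bounded operators on a
   Banach space this already forces the boundary maps to have closed range. *)
Definition koszul_fredholm A1 A2 : Prop :=
  [/\ fin_dim_quotient [set u | koszul0 A1 A2 u = 0] [set 0],
      fin_dim_quotient [set p | koszul1 A1 A2 p = 0] (range (koszul0 A1 A2)) &
      fin_dim_quotient setT (range (koszul1 A1 A2))].

Definition sub_scalar (T : H -> H) (lam : R[i]) (u : H) : H := T u - lam *: u.

Definition taylor_spectrum (T1 T2 : H -> H) : set (R[i] * R[i]) :=
  [set lam | ~ koszul_exact (sub_scalar T1 lam.1) (sub_scalar T2 lam.2)].

Definition taylor_essential_spectrum (T1 T2 : H -> H) : set (R[i] * R[i]) :=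
  [set lam | ~ koszul_fredholm (sub_scalar T1 lam.1) (sub_scalar T2 lam.2)].
End Koszul.

Section WeightedShifts.
Variable R : realType.

Definition weighted_shift (w : nat -> R)
    (W : {linear ell2 R nat -> ell2 R nat}) : Prop :=
  bounded_operator W /\
  forall n, W (ell2_basis R n) = (w n)%:C *: ell2_basis R n.+1.

Definition bergman_weight (l n : nat) : R :=
  Num.sqrt (l%:R - n.+2%:R^-1).

(* alpha i j and beta i j are the weights at the lattice point (i, j): i is the
   horizontal coordinate, so row j is the sequence alpha 0 j, alpha 1 j, ... *)
Record weighted_shift2 (alpha beta : nat -> nat -> R)
    (T1 T2 : {linear ell2 R (nat * nat)%type -> ell2 R (nat * nat)%type}) :
    Prop := WeightedShift2 {
  ws2_weight1_gt0 : forall i j, 0 < alpha i j;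
  ws2_weight2_gt0 : forall i j, 0 < beta i j;
  ws2_weight1_bounded : exists M, forall i j, alpha i j <= M;
  ws2_weight2_bounded : exists M, forall i j, beta i j <= M;
  ws2_bounded1 : bounded_operator T1;
  ws2_bounded2 : bounded_operator T2;
  ws2_shift1 : forall i j, T1 (ell2_basis R (i, j)) =
    (alpha i j)%:C *: ell2_basis R (i.+1, j);
  ws2_shift2 : forall i j, T2 (ell2_basis R (i, j)) =
    (beta i j)%:C *: ell2_basis R (i, j.+1) }.

Definition closed_disk : set R[i] := [set z | `|z| <= 1].

Definition unit_circle : set R[i] := [set z | `|z| = 1].

Definition dilate (r : R) (A : set R[i]) : set R[i] := [set r%:C * z | z in A].
End WeightedShifts.

Arguments closed_disk {R}.
Arguments unit_circle {R}.

(* Main.v *)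
Require Import Defs.
From mathcomp Require Import all_boot all_order all_algebra.
From mathcomp Require Import complex.
From mathcomp Require Import all_classical all_reals.
From mathcomp Require Import ereal topology normedtype numfun esum sequences.
From mathcomp Require Import finmap ring lra zify.
Set Implicit Arguments.
Unset Strict Implicit.
Unset Printing Implicit Defensive.
Import Order.TTheory GRing.Theory Num.Theory.
Import numFieldNormedType.Exports.
Import Normc.
Local Open Scope classical_set_scope.
Local Open Scope complex_scope.
Local Open Scope ring_scope.

(** Put A1 = T1 - lam1 and A2 = T2 - lam2. Both operators are injective, because
    shifts with positive weights have no eigenvalues. Hence the homology of the
    Koszul complex at (lam1, lam2) is 0 in the first place, and in the other two
    the kernel and the cokernel of A2 on the quotient by the range of A1.

    The weights. Commutation gives
    beta (i+1) j * alpha i j = alpha i (j+1) * beta i j, so if adjacent rows have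
    asymptotically different weights, then the vertical weights between them grow
    or decay geometrically. As they are bounded, l 0 >= ... >= l (k-1), and
    l (k-1) >= 2 since the next row is unweighted and l (k-1) = 1 would give
    growth like the square root of i. So b j = sqrt (l j) is nonincreasing and
    larger than 1, every horizontal weight is at least 1, and the vertical
    weights tend to 0 along each row above which b drops, including row k - 1.

    The rows from k on carry the unilateral shift tensored with
    shift(w k, w (k+1), ...), and T2 moves every vector there in k steps.
    - If |lam2| > c, then modulo the range of A2 each y equals (T2 / lam2)^k y,
      which lies in these rows, where a Neumann series inverts A2: exactness
      (exact_above).
    - If |lam1| > 1, these rows lie in the range of A1. For lam2 != 0 the same
      device gives exactness (exact_right). For lam2 = 0 everything depends on A1
      in the first k rows, where it is onto for |lam1| > b j and has a
      complement of finite dimension for |lam1| < b j (exact_beyond_rows,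
      fredholm_off_circles). The first basis vector is not in the range when
      |lam1| < b 0 (not_exact_row0).
    - If |lam1| < 1, a left inverse of T1 shows that the 0-th column is a
      complement of the range of A1; on it T2 acts as W. Thus the question is
      reduced to W - lam2, which for |lam2| < c is injective with a range of
      finite nonzero codimension (fredholm_inside, not_exact_inside).

    On the remaining points A1 and A2 have joint approximate null vectors for
    their adjoints that move off to infinity: tensor products of approximate
    eigenvectors of backward shifts, a long window of a pure oscillation
    (backward_shift_far) in a direction in which the parameter lies on the
    critical circle. They leak into the row below through a vertical weight; this
    is harmless because the weight tends to 0 or because the window starts
    higher up. A gliding hump argument turns such vectors into an
    infinite-dimensional cokernel (almost_orthogonal_not_fredholm), without
    assuming that the range is closed. *)

(** * Moduli and norms *)

Section ComplexModulus.
Variable R : realType.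
Implicit Types z w : R[i].

Lemma normcD z w : normc (z + w) <= normc z + normc w.
Proof. exact: le_normcD. Qed.

Lemma normcNz z : normc (- z) = normc z.
Proof. exact: normcN. Qed.

Lemma normc_realE (r : R) : normc r%:C = `|r|.
Proof. by rewrite /= expr0n addr0 sqrtr_sqr. Qed.

Lemma normcJ z : normc z^* = normc z.
Proof. by case: z => a b /=; rewrite sqrrN. Qed.

Lemma normc_eq0 z : (normc z == 0) = (z == 0).
Proof.
apply/eqP/eqP => [|->]; first exact: eq0_normc.
exact: normc0.
Qed.

Lemma normcX z n : normc (z ^+ n) = normc z ^+ n.
Proof.
elim: n => [|n IH]; first exact: normc1.
by rewrite !exprS normcM IH.
Qed.

Lemma real_complexV (r : R) : (r^-1)%:C = (r%:C)^-1 :> R[i].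
Proof. exact: (fmorphV (real_complex R)). Qed.

Lemma real_complexM (r s : R) : (r * s)%:C = r%:C * s%:C :> R[i].
Proof. exact: (rmorphM (real_complex R)). Qed.

Lemma real_complexB (r s : R) : (r - s)%:C = r%:C - s%:C :> R[i].
Proof. exact: (rmorphB (real_complex R)). Qed.
End ComplexModulus.

Section SquareSums.
Variables (R : realType) (I J : choiceType).

Lemma sqsum_pullback_le (s : I -> J) (r : R) (x : I -> R[i]) (y : J -> R[i]) :
    injective s -> (forall i, normc (x i) <= r * normc (y (s i))) ->
  (sqsum x <= (r ^+ 2)%:E * sqsum y)%E.
Proof.
move=> inj_s xy.
have sq0 (z : J -> R[i]) j : 0 <= normc (z j) ^+ 2 by rewrite sqr_ge0.
apply: (@le_trans _ _ (ssum (fun i => r ^+ 2 * normc (y (s i)) ^+ 2))).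
  apply: le_ssum => i; rewrite -exprMn ler_sqr ?nnegrE ?normc_ge0//.
  exact: le_trans (normc_ge0 _) (xy i).
rewrite ssumZ ?sqr_ge0//.
rewrite lee_wpmul2l ?lee_fin ?sqr_ge0//.
rewrite /ssum -(@esum_image _ _ _ setT s (fun j => (normc (y j) ^+ 2)%:E)).
  rewrite esum_mkcond; apply: le_esum => j _.
  by case: ifP => // _; rewrite lee_fin.
by move=> i j _ _; exact: inj_s.
Qed.

Lemma sqsum_pushforward_le (f : I -> J) (r : R) (x : J -> R[i]) (y : I -> R[i]) :
    injective f -> (forall i, normc (x (f i)) <= r * normc (y i)) ->
    (forall j, ~ range f j -> x j = 0) ->
  (sqsum x <= (r ^+ 2)%:E * sqsum y)%E.
Proof.
move=> inj_f xy x0.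
have sq0 (z : I -> R[i]) j : 0 <= normc (z j) ^+ 2 by rewrite sqr_ge0.
have -> : sqsum x = ssum (fun i => normc (x (f i)) ^+ 2).
  rewrite /ssum -(@esum_image _ _ _ setT f (fun j => (normc (x j) ^+ 2)%:E)).
    rewrite [RHS]esum_mkcond; apply: eq_esum => j _.
    case: ifPn => // /negP jf; rewrite x0 ?normc0 ?expr0n// => fj.
    by apply: jf; exact/mem_set.
  by move=> i j _ _; exact: inj_f.
rewrite -ssumZ ?sqr_ge0//; apply: le_ssum => i.
rewrite -exprMn ler_sqr ?nnegrE ?normc_ge0//.
exact: le_trans (normc_ge0 _) (xy i).
Qed.
End SquareSums.

Section Ell2.
Variables (R : realType) (I : choiceType).
Notation V := (ell2_type R I).
Implicit Types (x y : V).

Lemma ell2P x y : (forall i, x i = y i) -> x = y.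
Proof. by move=> xy; apply/val_inj/funext => i; exact: xy. Qed.

Lemma ell2DE x y i : (x + y) i = x i + y i. Proof. by []. Qed.
Lemma ell2BE x y i : (x - y) i = x i - y i. Proof. by []. Qed.
Lemma ell2NE x i : (- x) i = - x i. Proof. by []. Qed.
Lemma ell2ZE (a : R[i]) x i : (a *: x) i = a * x i. Proof. by []. Qed.
Lemma ell20E i : (0 : V) i = 0. Proof. by []. Qed.
Lemma ell2deltaE (i j : I) : ell2_delta R i j = (j == i)%:R. Proof. by []. Qed.
Definition ell2E := (ell2BE, ell2DE, ell2NE, ell2ZE, ell20E, ell2deltaE).

Lemma ell2_sumE (K : Type) (r : seq K) (F : K -> V) i :
  (\sum_(a <- r) F a) i = \sum_(a <- r) F a i.
Proof. by elim/big_rec2: _ => // a y1 y2 _ <-; rewrite ell2E. Qed.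

Lemma ell2_norm0 : ell2_norm (0 : V) = 0.
Proof. by rewrite -(scale0r (0 : V)) ell2_normZ normc0 mul0r. Qed.

Lemma ell2_norm_delta (i : I) : ell2_norm (ell2_delta R i) = 1.
Proof.
apply/eqP; rewrite -(@eqrXn2 _ 2)// ?ell2_norm_ge0// expr1n.
rewrite -eqe -sqsum_normE /sqsum (@ssum_finite _ _ [set i])//.
- by rewrite fsbig_set1 ell2E eqxx normc1 expr1n.
- by move=> j; rewrite sqr_ge0.
- by move=> j /eqP/negPf ji; rewrite ell2E ji normc0 expr0n.
Qed.

Lemma ell2_normN x : ell2_norm (- x) = ell2_norm x.
Proof. by rewrite -scaleN1r ell2_normZ normcNz normc1 mul1r. Qed.

Lemma ell2_normB x y : ell2_norm (x - y) <= ell2_norm x + ell2_norm y.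
Proof. by rewrite -(ell2_normN y); exact: ell2_normD. Qed.

Lemma ell2_normr x : `|x| = (ell2_norm x)%:C. Proof. by []. Qed.

(** A vector given by its coordinates; meaningful only when they are square
    summable, and zero otherwise, so that no proof has to be carried around. *)
Definition ell2_of (h : I -> R[i]) : V := insubd (0 : V) h.

Lemma ell2_ofE h i : h \in square_summable (R:=R) (I:=I) -> ell2_of h i = h i.
Proof. by move=> hP; rewrite -[ell2_fun _]/(val _) val_insubd hP. Qed.

End Ell2.

Section NormBounds.
Variable R : realType.

Let sqsum_norm_le (I J : choiceType) (r : R) (x : ell2_type R I)
    (y : ell2_type R J) : 0 <= r ->
  (sqsum x <= (r ^+ 2)%:E * sqsum y)%E -> ell2_norm x <= r * ell2_norm y.
Proof.
move=> r0; rewrite !sqsum_normE -EFinM lee_fin -exprMn.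
by rewrite ler_sqr ?nnegrE ?mulr_ge0 ?ell2_norm_ge0.
Qed.

Lemma ell2_of_pullback (I J : choiceType) (s : I -> J) (r : R) (h : I -> R[i])
    (y : ell2_type R J) :
    injective s -> (forall i, normc (h i) <= r * normc (y (s i))) ->
  h \in square_summable (R:=R) (I:=I).
Proof.
move=> inj_s hy; rewrite unfold_in.
apply: le_lt_trans (sqsum_pullback_le inj_s hy) _.
by rewrite sqsum_normE -EFinM ltry.
Qed.

Lemma ell2_norm_pullback (I J : choiceType) (s : I -> J) (r : R)
    (x : ell2_type R I) (y : ell2_type R J) : 0 <= r -> injective s ->
    (forall i, normc (x i) <= r * normc (y (s i))) ->
  ell2_norm x <= r * ell2_norm y.
Proof.
by move=> r0 inj_s xy; apply: sqsum_norm_le => //; exact: sqsum_pullback_le xy.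
Qed.

Lemma ell2_norm_le (I : choiceType) (r : R) (x y : ell2_type R I) : 0 <= r ->
  (forall i, normc (x i) <= r * normc (y i)) -> ell2_norm x <= r * ell2_norm y.
Proof. by move=> r0; apply: (@ell2_norm_pullback _ _ id). Qed.

Lemma ell2_norm_pushforward (I J : choiceType) (f : I -> J) (r : R)
    (x : ell2_type R J) (y : ell2_type R I) : 0 <= r -> injective f ->
    (forall i, normc (x (f i)) <= r * normc (y i)) ->
    (forall j, ~ range f j -> x j = 0) ->
  ell2_norm x <= r * ell2_norm y.
Proof.
move=> r0 inj_f xy x0; apply: sqsum_norm_le => //.
exact: sqsum_pushforward_le xy x0.
Qed.
End NormBounds.

(** * Density of finitely supported vectors *)

Section Density.
Variables (R : realType) (I : choiceType).
Notation V := (ell2_type R I).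

Lemma ell2_tail (x : V) (e : R) : 0 < e ->
  exists A : {fset I}, ell2_norm (x - \sum_(i <- A) x i *: ell2_delta R i) <= e.
Proof.
move=> e0; have e20 : 0 < e ^+ 2 by rewrite exprn_gt0.
have : (sqsum x - (e ^+ 2)%:E < sqsum x)%E.
  by rewrite lteBlDr ?lteDl ?lte_fin// sqsum_fin_num.
move=> /ereal_sup_gt[_ [A [finA _] <-]]; rewrite fsbig_finite//= => Ae.
exists (fset_set A); set y := x - _.
have yE i : y i = if i \in fset_set A then 0 else x i.
  rewrite ell2E ell2_sumE; case: ifPn => iA; last first.
    rewrite big1_seq ?subr0// => j /andP[_ jA]; rewrite !ell2E.
    by case: eqP => [ij|]; rewrite ?mulr0//; move: iA; rewrite ij jA.
  rewrite (big_fsetD1 i)// big1_seq; last first.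
    move=> j /andP[_]; rewrite !inE => /andP[/negPf ji _]; rewrite !ell2E.
    by rewrite eq_sym ji mulr0.
  by rewrite !ell2E eqxx mulr1 Monoid.mulm1 subrr.
have sq0 (z : I -> R[i]) i : 0 <= normc (z i) ^+ 2 by rewrite sqr_ge0.
pose z i := if i \in fset_set A then x i else 0.
have : sqsum x = (sqsum y + sqsum z)%E.
  rewrite /sqsum -ssumD//; congr ssum; apply/funext => i.
  by rewrite yE /z; case: ifP; rewrite normc0 expr0n ?addr0 ?add0r.
have -> : sqsum z = (\sum_(i <- fset_set A) (normc (x i) ^+ 2)%:E)%E.
  rewrite /sqsum (ssum_finite finA)//; last first.
    move=> i iA; rewrite /z in_fset_set//; case: ifP; rewrite ?normc0 ?expr0n//.
    by move=> /set_mem.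
  rewrite fsbig_finite//=; apply: eq_big_seq => i iA.
  by rewrite /z iA.
rewrite !sqsum_normE !sumEFin in Ae * => -[xE].
move: Ae; rewrite -EFinB lte_fin xE => Ae.
rewrite -ler_sqr ?nnegrE ?ell2_norm_ge0 ?(ltW e0)//.
by move: Ae; set s := \sum_(i <- _) _; lra.
Qed.

(** This is how an operator is recovered from its action on the basis: apply it
    to the difference between a coordinate of T x and its expected value. *)
Lemma ell2_functional_eq0 (phi : V -> R[i]) (M : R) :
    (forall a x y, phi (a *: x + y) = a * phi x + phi y) ->
    (forall x, normc (phi x) <= M * ell2_norm x) ->
    (forall i, phi (ell2_delta R i) = 0) ->
  forall x, phi x = 0.
Proof.
move=> philin phiM phi0 x; apply/eqP; rewrite -normc_eq0; apply/eqP.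
have phi00 : phi 0 = 0 by have := philin (- 1) 0 0; rewrite scaler0 addr0 mulN1r addNr.
have phisum (A : {fset I}) : phi (\sum_(i <- A) x i *: ell2_delta R i) = 0.
  elim/big_ind: _ => // [y z y0 z0|i _].
    by rewrite -[y]scale1r philin y0 z0 mulr0 addr0.
  by rewrite -[_ *: _]addr0 philin phi0 phi00 mulr0 addr0.
have small e : 0 < e -> normc (phi x) <= `|M| * e.
  move=> /(ell2_tail x)[A Ae].
  have -> : phi x = phi (x - \sum_(i <- A) x i *: ell2_delta R i).
    by rewrite addrC -scaleN1r philin phisum mulr0 add0r.
  apply: le_trans (phiM _) _; apply: (le_trans (ler_wpM2r (ell2_norm_ge0 _) (ler_norm M))).
  exact: ler_wpM2l.
apply/eqP; rewrite eq_le normc_ge0 andbT; apply/ler_addgt0Pr => e e0.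
rewrite add0r; have M0 : 0 < `|M| + 1 by rewrite ltr_wpDl.
apply: le_trans (small (e / (`|M| + 1)) _) _; first by rewrite divr_gt0.
by rewrite mulrA ler_pdivrMr// mulrC ler_pM2l// lerDl.
Qed.
End Density.

(** * Geometric series *)

Lemma expr_lt_small (R : realType) (q e : R) : 0 <= q < 1 -> 0 < e ->
  exists n, forall m, (n <= m)%N -> q ^+ m < e.
Proof.
move=> /andP[q0 q1] e0.
have : (fun n => q ^+ n) @ \oo --> (0 : R) by apply: cvg_expr; rewrite ger0_norm.
move=> /cvgrPdist_lt/(_ e e0)[n _ nq]; exists n => m nm.
by have := nq m nm; rewrite /= sub0r normrN ger0_norm ?exprn_ge0.
Qed.

Section GeometricSeries.
Variables (R : realType) (I : choiceType).
Notation V := (ell2_type R I).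

Lemma ell2_geometric_series (u : nat -> V) (C q : R) : 0 <= q < 1 ->
    (forall n, ell2_norm (u n) <= C * q ^+ n) ->
  exists x : V, forall n,
    ell2_norm (x - \sum_(i < n) u i) <= C / (1 - q) * q ^+ n.
Proof.
move=> q01 uq; have /andP[q0 q1] := q01.
have q1' : 0 < 1 - q by rewrite subr_gt0.
have C0 : 0 <= C by have := uq 0%N; rewrite expr0 mulr1; apply: le_trans (ell2_norm_ge0 _).
pose s n := \sum_(i < n) u i.
have step n d : ell2_norm (s (n + d)%N - s n) <= C / (1 - q) * q ^+ n * (1 - q ^+ d).
  elim: d => [|d IH]; first by rewrite addn0 subrr ell2_norm0 subrr mulr0.
  rewrite addnS /s big_ord_recr /= -/(s _) addrAC.
  apply: le_trans (ell2_normD _ _) _; apply: le_trans (lerD IH (uq _)) _.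
  rewrite exprD exprS le_eqVlt; apply/orP; left; apply/eqP.
  by field; rewrite gt_eqF.
have near n m : (n <= m)%N -> ell2_norm (s m - s n) <= C / (1 - q) * q ^+ n.
  move=> nm; rewrite -(subnKC nm); apply: le_trans (step _ _) _.
  rewrite ler_piMr ?mulr_ge0 ?invr_ge0 ?exprn_ge0 ?(ltW q1')//.
  by rewrite gerBl exprn_ge0.
have small e : 0 < e -> exists n, C / (1 - q) * q ^+ n < e.
  move=> e0; have K0 : 0 <= C / (1 - q) by rewrite divr_ge0// ltW.
  have K1 : 0 < C / (1 - q) + 1 by rewrite ltr_wpDl.
  have [|n /(_ n (leqnn n)) nq] := @expr_lt_small _ q (e / (C / (1 - q) + 1)) q01.
    by rewrite divr_gt0.
  exists n; move: nq; rewrite ltr_pdivlMr// mulrC; apply: le_lt_trans.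
  by rewrite ler_wpM2r ?exprn_ge0// lerDl.
have cs : cvg (s @ \oo).
  apply/cauchy_cvgP/cauchyP => e e0.
  have [r r0 ->] : exists2 r : R, 0 < r & e = r%:C.
    exists (complex.Re e); first by move: e0; rewrite ltcE => /andP[].
    by rewrite RRe_real// gtr0_real.
  have [n nr] := small _ r0.
  exists (s n); exists n => // m /= nm.
  suff: `|s n - s m| < r%:C by [].
  by rewrite distrC ell2_normr ltcR; apply: le_lt_trans (near _ _ nm) nr.
exists (lim (s @ \oo)) => n; rewrite -/(s n).
apply/ler_addgt0Pr => e e0.
have /cvgrPdist_lt/(_ e%:C)[|m _ me] := cs; first by rewrite ltcR.
have {me} := me (maxn m n) (leq_maxl _ _).
rewrite /= -[X in X < _]/((ell2_norm _)%:C) ltcR => me.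
rewrite -(subrKA (s (maxn m n))) addrC.
apply: le_trans (ell2_normD _ _) _; rewrite lerD ?(ltW me)//.
exact: near (leq_maxr _ _).
Qed.

(** Neumann series: it suffices that the orbit of the given vector decays. *)
Lemma ell2_neumann (G : V -> V) (M C q : R) (y : V) : 0 <= q < 1 ->
    (forall x1 x2, G (x1 - x2) = G x1 - G x2) ->
    (forall x, ell2_norm (G x) <= M * ell2_norm x) ->
    (forall n, ell2_norm (iter n G y) <= C * q ^+ n) ->
  exists x, x - G x = y.
Proof.
move=> q01 GB GM Gy; have /andP[q0 q1] := q01.
have [x xs] := ell2_geometric_series q01 Gy.
pose s n := \sum_(i < n) iter i G y.
have G0 : G 0 = 0 by have := GB 0 0; rewrite !subrr.
have GN z : G (- z) = - G z by rewrite -sub0r GB G0 sub0r.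
have sG n : s n - G (s n) = y - iter n G y.
  elim: n => [|n IH]; first by rewrite /s big_ord0 G0 /= !subrr.
  rewrite /s big_ord_recr /= -/(s n) -[X in G (_ + X)]opprK GB GN opprK.
  rewrite opprD addrACA IH addrA subrK //.
exists x; apply/eqP; rewrite -subr_eq0; apply/eqP; apply: ell2_norm_eq0; apply/eqP.
rewrite eq_le ell2_norm_ge0 andbT.
pose K := C / (1 - q) + `|M| * (C / (1 - q)) + C.
have bound n : ell2_norm (x - G x - y) <= K * q ^+ n.
  have -> : x - G x - y = (x - s n) - G (x - s n) - iter n G y.
    have -> : iter n G y = y - (s n - G (s n)) by rewrite sG subKr.
    by rewrite GB; apply: ell2P => i; rewrite !ell2E; ring.
  have xsn : ell2_norm (x - s n) <= C / (1 - q) * q ^+ n by exact: xs.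
  have Gxsn : ell2_norm (G (x - s n)) <= `|M| * (C / (1 - q) * q ^+ n).
    apply: le_trans (GM _) _.
    apply: (le_trans (ler_wpM2r (ell2_norm_ge0 _) (ler_norm M))).
    by rewrite ler_wpM2l.
  apply: le_trans (ell2_normB _ _) _.
  have := ell2_normB (x - s n) (G (x - s n)); have := Gy n; rewrite /K.
  nra.
apply/ler_addgt0Pr => e e0; rewrite add0r.
have K1 : 0 < `|K| + 1 by rewrite ltr_wpDl.
have [|n /(_ n (leqnn n)) nq] := @expr_lt_small _ q (e / (`|K| + 1)) q01.
  by rewrite divr_gt0.
apply: le_trans (bound n) _; move: nq; rewrite ltr_pdivlMr// mulrC => /ltW.
apply: le_trans; rewrite ler_wpM2r ?exprn_ge0//.
by apply: (le_trans (ler_norm K)); rewrite lerDl.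
Qed.
End GeometricSeries.

(** * Weighted translations of an index set *)

Section BoundedOperators.
Variables (R : realType) (I : choiceType).
Notation V := (ell2_type R I).

Lemma bounded_operatorP (T : {linear ell2 R I -> ell2 R I}) :
  bounded_operator T -> exists2 M : R, 0 <= M &
    forall x : V, ell2_norm (T x : V) <= M * ell2_norm x.
Proof.
move=> [M TM]; exists `|M| => // x.
have := TM x; rewrite -[X in X <= _]/((ell2_norm (T x : V))%:C).
rewrite -[X in _ * X]/((ell2_norm (x : V))%:C) -rmorphM lecR => /le_trans; apply.
by rewrite ler_wpM2r ?ell2_norm_ge0 ?ler_norm.
Qed.

(** A weighted translation of the index set: both unilateral weighted shifts
    and each coordinate of a 2-variable weighted shift have this form. *)
Definition index_shift (f : I -> I) (a : I -> R) (T : {linear V -> V}) : Prop :=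
  [/\ injective f,
      exists2 M : R, 0 <= M & forall x : V, ell2_norm (T x) <= M * ell2_norm x &
      forall i, T (ell2_delta R i) = (a i)%:C *: ell2_delta R (f i)].
End BoundedOperators.

Section IndexShift.
Variables (R : realType) (I : choiceType).
Notation V := (ell2_type R I).
Variables (f : I -> I) (a : I -> R) (T : {linear V -> V}).
Hypothesis shT : index_shift f a T.

Lemma index_shift_coord (x : V) i : T x (f i) = (a i)%:C * x i.
Proof.
have [inj_f [M M0 TM] Td] := shT.
apply/eqP; rewrite -subr_eq0; apply/eqP.
apply: (@ell2_functional_eq0 _ _ (fun x : V => T x (f i) - (a i)%:C * x i)
  (M + `|a i|)).
- by move=> b y z; rewrite linearP !ell2E; ring.
- move=> y; apply: le_trans (normcD _ _) _; rewrite normcNz normcM normc_realE.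
  rewrite mulrDl lerD//; first exact: le_trans (ell2_norm_coord _ _) (TM y).
  by rewrite ler_wpM2l// ell2_norm_coord.
- move=> j; rewrite Td !ell2E (inj_eq inj_f).
  by case: eqP => [->|]; rewrite ?mulr0 subrr.
Qed.

Lemma index_shift_coord0 (x : V) j : ~ range f j -> T x j = 0.
Proof.
have [inj_f [M M0 TM] Td] := shT => jf.
apply: (@ell2_functional_eq0 _ _ (fun x : V => T x j) M).
- by move=> b y z; rewrite linearP !ell2E.
- by move=> y; exact: le_trans (ell2_norm_coord _ _) (TM y).
- move=> i; rewrite Td !ell2E; case: eqP; rewrite ?mulr0// => jE.
  by exfalso; apply: jf; exists i.
Qed.

Lemma index_shift_norm_le (M : R) (x : V) : 0 <= M ->
    (forall i, x i != 0 -> `|a i| <= M) ->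
  ell2_norm (T x) <= M * ell2_norm x.
Proof.
move=> M0 aM; have [inj_f _ _] := shT.
apply: (ell2_norm_pushforward M0 inj_f); last exact: index_shift_coord0.
move=> i; rewrite index_shift_coord normcM normc_realE.
have [->|x0] := eqVneq (x i) 0; first by rewrite normc0 !mulr0.
by rewrite ler_wpM2r ?normc_ge0 ?aM.
Qed.

(** The vectors supported in D form a T-invariant subspace, on which T / lam is
    a strict contraction. *)
Lemma index_shift_solve_forward (D : pred I) (q : R) (lam : R[i]) (y : V) :
    0 <= q < 1 -> lam != 0 ->
    (forall i, D i -> D (f i)) ->
    (forall i, D i -> `|a i| <= q * normc lam) ->
    (forall i, ~~ D i -> y i = 0) ->
  exists x : V, T x - lam *: x = y.
Proof.
move=> q01 lam0 Df aD yD; have /andP[q0 _] := q01.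
have [inj_f [M M0 TM] _] := shT.
have lam_gt0 : 0 < normc lam by rewrite lt_def normc_eq0 lam0 normc_ge0.
pose G (x : V) : V := lam^-1 *: T x.
have GD (x : V) : (forall i, ~~ D i -> x i = 0) ->
    (forall i, ~~ D i -> G x i = 0) /\ ell2_norm (G x) <= q * ell2_norm x.
  move=> xD; split=> [i iD|].
    rewrite /G ell2E; have [[j _ jE]|/index_shift_coord0 ->] := pselect (range f i).
      rewrite -jE index_shift_coord xD ?mulr0//.
      by apply: contra iD; rewrite -jE; exact: Df.
    by rewrite mulr0.
  rewrite /G ell2_normZ normcV mulrC ler_pdivrMr// mulrAC.
  apply: index_shift_norm_le => [|i xi]; first by rewrite mulr_ge0// normc_ge0.
  by apply: aD; apply: contraNT xi => /xD ->.
have Gy n : (forall i, ~~ D i -> iter n G y i = 0) /\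
    ell2_norm (iter n G y) <= ell2_norm y * q ^+ n.
  elim: n => [|n [IHD IHn]]; first by rewrite expr0 mulr1.
  have [GD1 GD2] := GD _ IHD; split=> //=; apply: le_trans GD2 _.
  by rewrite exprS mulrCA ler_wpM2l.
have [|||z zE] := @ell2_neumann _ _ G (normc lam^-1 * M) (ell2_norm y) q y q01.
- by move=> x1 x2; rewrite /G linearB scalerBr.
- by move=> x; rewrite /G ell2_normZ -mulrA ler_wpM2l ?normc_ge0.
- by move=> n; have [] := Gy n.
exists (- lam^-1 *: z).
rewrite linearZ /= scaleNr -/(G z) scaleNr scalerN opprK scalerA divff// scale1r.
by rewrite -zE addrC.
Qed.

(** Where the weights dominate |lam|, the shift has a left inverse L, and
    T - lam = (1 - lam L) T with 1 - lam L invertible: a vector y = z - lam L z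
    equals (T - lam) (L z) + (z - T L z), and z - T L z lives off f(D). *)
Lemma index_shift_solve_backward (D : pred I) (q m : R) (lam : R[i]) (y : V) :
    0 <= q < 1 -> 0 < m -> normc lam <= q * m ->
    (forall i, D i -> m <= a i) ->
  exists p r : V, [/\ y = (T p - lam *: p) + r,
    forall i, D i -> r (f i) = 0 &
    forall i, ~~ D i -> (forall j, D j -> f j <> i) -> r i = y i].
Proof.
move=> q01 m0 lamm mD; have /andP[q0 _] := q01.
have [inj_f [M M0 TM] _] := shT.
pose h (x : V) i : R[i] := if D i then (a i)^-1%:C * x (f i) else 0.
have hx (x : V) i : normc (h x i) <= m^-1 * normc (x (f i)).
  rewrite /h; case: ifPn => iD; last first.
    by rewrite normc0 mulr_ge0 ?normc_ge0 ?invr_ge0 ?ltW.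
  have ai := lt_le_trans m0 (mD _ iD).
  rewrite normcM normc_realE ler_wpM2r ?normc_ge0//.
  by rewrite gtr0_norm ?invr_gt0// lef_pV2 ?posrE ?mD.
pose L (x : V) : V := ell2_of (h x).
have LE (x : V) i : L x i = h x i.
  exact: (ell2_ofE _ (ell2_of_pullback inj_f (hx x))).
have LB (x1 x2 : V) : L (x1 - x2) = L x1 - L x2.
  apply: ell2P => i; rewrite !ell2E !LE /h; case: ifP => _; rewrite ?subr0//.
  by rewrite ell2E mulrBr.
pose G (x : V) : V := lam *: L x.
have Gq (x : V) : ell2_norm (G x) <= q * ell2_norm x.
  apply: (ell2_norm_pullback q0 inj_f) => i; rewrite ell2E LE normcM.
  have := ler_wpM2l (normc_ge0 lam) (hx x i) => /le_trans; apply.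
  by rewrite mulrA ler_wpM2r ?normc_ge0// ler_pdivrMr.
have Gy n : ell2_norm (iter n G y) <= ell2_norm y * q ^+ n.
  elim: n => [|n IHn]; first by rewrite expr0 mulr1.
  by apply: le_trans (Gq _) _; rewrite exprS mulrCA ler_wpM2l.
have [|z zE] := @ell2_neumann _ _ G q (ell2_norm y) q y q01 _ Gq Gy.
  by move=> x1 x2; rewrite /G LB scalerBr.
exists (L z), (z - T (L z)); split.
- by rewrite -zE /G; apply: ell2P => i; rewrite !ell2E; ring.
- move=> i iD; rewrite ell2E index_shift_coord LE /h iD mulrA -rmorphM /=.
  rewrite divff ?rmorph1 ?mul1r ?subrr//.
  by rewrite gt_eqF// (lt_le_trans m0) ?mD.
- move=> i iD fi; rewrite -zE !ell2E LE /h (negbTE iD) mulr0 subr0.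
  have [[j _ jE]|/index_shift_coord0 ->] := pselect (range f i); last first.
    by rewrite subr0.
  have jD : ~~ D j by apply/negP => /fi.
  by rewrite -jE index_shift_coord LE /h (negbTE jD) mulr0 subr0.
Qed.

(** For lam != 0 an eigenvector vanishes off the range of f, hence by induction
    on the rank along all forward orbits; for lam = 0 use that no weight is 0. *)
Lemma index_shift_inj (lam : R[i]) (rank : I -> nat) (x : V) :
    (forall i, 0 < a i) -> (forall i, rank (f i) = (rank i).+1) ->
    T x - lam *: x = 0 -> x = 0.
Proof.
move=> a0 rankf /eqP; rewrite subr_eq0 => /eqP Tx.
have [lam0|lam0] := eqVneq lam 0.
  apply: ell2P => i; have := index_shift_coord x i.
  rewrite Tx lam0 scale0r ell2E => /esym/eqP; rewrite mulf_eq0.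
  by case/orP => /eqP // /complexI/eqP; rewrite gt_eqF.
suff H n i : rank i = n -> x i = 0 by apply: ell2P => i; exact: H.
elim: n i => [|n IH] i ri; apply: (mulfI lam0); rewrite mulr0 -ell2ZE -Tx.
  by apply: index_shift_coord0 => -[j _ jE]; move: ri; rewrite -jE rankf.
have [[j _ jE]|/index_shift_coord0//] := pselect (range f i).
rewrite -jE index_shift_coord IH ?mulr0//.
by move: ri; rewrite -jE rankf => -[].
Qed.
End IndexShift.

Lemma index_shift_restrict_forward (R : realType) (I : choiceType) (f : I -> I) (a : I -> R)
    (T : {linear ell2_type R I -> ell2_type R I})
    (D : pred I) (q : R) (lam : R[i]) (y : ell2_type R I) :
    index_shift f a T -> 0 <= q < 1 -> lam != 0 ->
    (forall i, D i -> D (f i)) ->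
    (forall i, D i -> `|a i| <= q * normc lam) ->
  exists p r : ell2_type R I, [/\ y = (T p - lam *: p) + r,
    forall i, D i -> r i = 0 & forall i, ~~ D i -> r i = y i].
Proof.
move=> shT q01 lam0 Df aD.
pose h i := if D i then y i else 0.
have hS : h \in square_summable (R:=R) (I:=I).
  apply: (@ell2_of_pullback _ _ _ id 1 h y) => // i; rewrite mul1r /h.
  by case: ifP => // _; rewrite normc0 normc_ge0.
have [|p pE] := index_shift_solve_forward (y := ell2_of h) shT q01 lam0 Df aD.
  by move=> i /negbTE iD; rewrite ell2_ofE// /h iD.
exists p, (y - ell2_of h); split; first by rewrite pE addrC subrK.
- by move=> i iD; rewrite ell2E ell2_ofE// /h iD subrr.
- by move=> i /negbTE iD; rewrite ell2E ell2_ofE// /h iD subr0.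
Qed.

Lemma opnorm_index_shift (R : realType) (I : choiceType) (f : I -> I)
    (a : I -> R) (M : R) (T : {linear ell2 R I -> ell2 R I}) :
    index_shift f a T -> 0 <= M -> (forall i, 0 <= a i <= M) ->
    (forall e, 0 < e -> exists i, M - e < a i) ->
  opnorm T = M.
Proof.
move=> shT M0 aM Ma; rewrite /opnorm; set S := [set r | _].
have ubS : ubound S M.
  move=> r [u u1 ur].
  have u1' : ell2_norm (u : ell2_type R I) <= 1 by rewrite -lecR.
  have <- : ell2_norm (T u : ell2_type R I) = r by apply: complexI; exact: ur.
  have := index_shift_norm_le shT (x := u) M0 _.
  move=> H; apply: le_trans (H _) _; last by rewrite ler_piMr.
  by move=> i _; have /andP[a0 ?] := aM i; rewrite ger0_norm.
have Sa i : S (a i).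
  exists (ell2_delta R i).
    by rewrite -[X in X <= _]/((ell2_norm (ell2_delta R i))%:C) ell2_norm_delta.
  have [_ _ Td] := shT; rewrite Td -[LHS]/((ell2_norm _)%:C) ell2_normZ.
  rewrite ell2_norm_delta mulr1 normc_realE ger0_norm//.
  by have /andP[] := aM i.
have [i0 _] := Ma _ ltr01.
apply/eqP; rewrite eq_le; apply/andP; split.
  by apply: ge_sup => //; exists (a i0).
apply/ler_addgt0Pr => e /Ma[i Mi].
rewrite -lerBlDr; apply: le_trans (ltW Mi) _.
by apply: ub_le_sup; [exists M|exact: Sa].
Qed.

(** * Finite codimension *)

Section FiniteCodimension.
Variables (R : realType) (H : lmodType R[i]).
Implicit Types (Z B : set H) (A : H -> H).

Definition vsubspace Z := Z 0 /\ forall a x y, Z x -> Z y -> Z (a *: x + y).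

Lemma vsubspaceB Z x y : vsubspace Z -> Z x -> Z y -> Z (x - y).
Proof. by move=> [_ Zl] Zx Zy; rewrite addrC -scaleN1r; exact: Zl. Qed.

Lemma vsubspaceZ Z a x : vsubspace Z -> Z x -> Z (a *: x).
Proof. by move=> [Z0 Zl] Zx; rewrite -[_ *: _]addr0; exact: Zl. Qed.

Lemma vsubspaceD Z x y : vsubspace Z -> Z x -> Z y -> Z (x + y).
Proof. by move=> [Z0 Zl] Zx Zy; rewrite -[x]scale1r; exact: Zl. Qed.

(** Unlike in fin_dim_quotient, the vectors need not belong to Z. *)
Definition spanned_mod Z B := exists (n : nat) (v : 'I_n -> H),
  forall z, Z z -> exists a : 'I_n -> R[i], B (z - \sum_(i < n) a i *: v i).

Lemma spanned_mod_sub Z Z' B B' :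
  Z `<=` Z' -> B' `<=` B -> spanned_mod Z' B' -> spanned_mod Z B.
Proof.
move=> ZZ BB [n [v vP]]; exists n, v => z /ZZ/vP[a Ha]; exists a; exact: BB.
Qed.

Lemma sub_spanned_mod Z B : Z `<=` B -> spanned_mod Z B.
Proof.
move=> ZB; exists 0%N, (fun=> 0) => z Zz; exists (fun=> 0).
by rewrite big_ord0 subr0; exact: ZB.
Qed.

Lemma unlift_max_widen n (i : 'I_n) :
  unlift ord_max (widen_ord (leqnSn n) i) = Some i.
Proof.
rewrite (_ : widen_ord _ _ = lift ord_max i) ?liftK//.
by apply/val_inj; rewrite /= /bump leqNgt ltn_ord.
Qed.

(** Finite codimension will be reached one basis vector at a time. *)
Lemma spanned_mod_line Z Z' B (e : H) :
    (forall z, Z' z -> exists2 c : R[i], True & Z (z - c *: e)) ->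
  spanned_mod Z B -> spanned_mod Z' B.
Proof.
move=> ZZ' [n [v vP]].
exists n.+1, (fun i => if unlift ord_max i is Some j then v j else e) => z Zz.
have [c _ /vP[a Ha]] := ZZ' z Zz.
exists (fun i => if unlift ord_max i is Some j then a j else c).
rewrite big_ord_recr /= unlift_none.
under eq_bigr => i _ do rewrite unlift_max_widen.
by rewrite opprD addrA addrAC.
Qed.

Lemma spanned_mod_add Z Z' B : vsubspace B ->
    (forall z, Z' z -> exists2 b, B b & Z (z - b)) ->
  spanned_mod Z B -> spanned_mod Z' B.
Proof.
move=> sB ZZ' [n [v vP]]; exists n, v => z /ZZ'[b Bb /vP[a Ba]]; exists a.
have -> : z - \sum_(i < n) a i *: v i = (z - b - \sum_(i < n) a i *: v i) + b.
  by rewrite [RHS]addrAC subrK.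
exact: vsubspaceD.
Qed.

(** Subspaces of finite-dimensional quotients are finite-dimensional, by
    induction on the number of spanning vectors: if some z0 in Z involves the
    last of them, then z0 can replace it, and otherwise it can be dropped. *)
Lemma fin_dim_quotient_spanned Z B : vsubspace Z -> vsubspace B -> B `<=` Z ->
  spanned_mod Z B -> fin_dim_quotient Z B.
Proof.
move=> sZ sB BZ [n]; elim: n Z sZ BZ => [|n IH] Z sZ BZ [v vP].
  by exists 0%N, v; split=> [[]//|z /vP].
pose v' (i : 'I_n) := v (widen_ord (leqnSn n) i).
pose Z' := [set z | Z z /\ exists a : 'I_n -> R[i], B (z - \sum_(i < n) a i *: v' i)].
have sZ' : vsubspace Z'.
  split.
    split; first by case: sZ.
    exists (fun=> 0); rewrite big1 ?subr0; last by move=> i _; rewrite scale0r.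
    by case: sB.
  move=> c x y [Zx [a Ba]] [Zy [b Bb]]; split; first by case: sZ => _; apply.
  exists (fun i => c * a i + b i).
  have -> : c *: x + y - \sum_(i < n) (c * a i + b i) *: v' i =
     c *: (x - \sum_(i < n) a i *: v' i) + (y - \sum_(i < n) b i *: v' i).
    rewrite scalerBr addrACA -opprD scaler_sumr -big_split /=; congr (_ - _).
    by apply: eq_bigr => i _; rewrite scalerDl scalerA.
  by case: sB => _; apply.
have BZ' : B `<=` Z'.
  move=> x Bx; split; first exact: BZ.
  exists (fun=> 0); rewrite big1 ?subr0// => i _; exact: scale0r.
have [m [u [uZ' uP]]] := IH Z' sZ' BZ' (ex_intro _ v' (fun z (h : Z' z) => h.2)).
have [ZZ'|] := pselect (Z `<=` Z').
  exists m, u; split=> [i|z /ZZ']; [by have [] := uZ' i|exact: uP].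
move=> /existsNP[z0 /not_implyP[Zz0 nZ'z0]].
have split_last z : Z z -> exists c (a : 'I_n -> R[i]),
    B (z - c *: v ord_max - \sum_(i < n) a i *: v' i).
  move=> /vP[a]; rewrite big_ord_recr /= opprD addrA addrAC => Ba.
  by exists (a ord_max), (fun i => a (widen_ord (leqnSn n) i)).
have [c [a Ba]] := split_last _ Zz0.
have c0 : c != 0.
  apply/eqP => c0; apply: nZ'z0; split=> //; exists a.
  by move: Ba; rewrite c0 scale0r subr0.
pose u' (i : 'I_m.+1) := if unlift ord_max i is Some j then u j else z0.
exists m.+1, u'; split=> [i|z Zz].
  by rewrite /u'; case: unliftP => [j _|_] //; have [] := uZ' j.
have [d [b Bb]] := split_last _ Zz.
have Z'z : Z' (z - (d / c) *: z0).
  split; first by apply: vsubspaceB => //; exact: vsubspaceZ.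
  exists (fun i => b i - (d / c) * a i).
  have -> : z - (d / c) *: z0 - \sum_(i < n) (b i - d / c * a i) *: v' i =
    - (d / c) *: (z0 - c *: v ord_max - \sum_(i < n) a i *: v' i) +
    (z - d *: v ord_max - \sum_(i < n) b i *: v' i).
    rewrite !scalerBr !scaleNr scalerA divfK// !opprK scaler_sumr.
    rewrite (eq_bigr (fun i => b i *: v' i - (d / c) *: (a i *: v' i))); last first.
      by move=> i _; rewrite scalerBl scalerA.
    rewrite sumrB; move: (\sum_(_ < _) _) (\sum_(_ < _) _) => s1 s2.
    move: (_ *: z0) (d *: _) => x1 x2.
    rewrite addrACA -[s1 - s2]opprB; congr (_ - _).
    by rewrite [- x1 + x2]addrC [RHS]addrC subrKA.
  by case: sB => _; apply.
have [f Bf] := uP _ Z'z.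
exists (fun i => if unlift ord_max i is Some j then f j else d / c).
rewrite big_ord_recr /= /u' unlift_none.
under eq_bigr => i _ do rewrite unlift_max_widen.
by rewrite opprD addrA addrAC.
Qed.
End FiniteCodimension.

(** * The Koszul complex of a commuting pair *)

Section KoszulPair.
Variables (R : realType) (H : lmodType R[i]) (A1 A2 : H -> H).
Hypothesis lin1 : forall a x y, A1 (a *: x + y) = a *: A1 x + A1 y.
Hypothesis lin2 : forall a x y, A2 (a *: x + y) = a *: A2 x + A2 y.
Hypothesis comm : forall x, A1 (A2 x) = A2 (A1 x).
Hypothesis inj1 : forall x, A1 x = 0 -> x = 0.

Let A10 : A1 0 = 0.
Proof. by have := lin1 (- 1) 0 0; rewrite scaler0 addr0 scaleN1r addNr. Qed.
Let A20 : A2 0 = 0.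
Proof. by have := lin2 (- 1) 0 0; rewrite scaler0 addr0 scaleN1r addNr. Qed.
Let A1B x y : A1 (x - y) = A1 x - A1 y.
Proof. by rewrite addrC -scaleN1r lin1 scaleN1r addrC. Qed.
Let A2B x y : A2 (x - y) = A2 x - A2 y.
Proof. by rewrite addrC -scaleN1r lin2 scaleN1r addrC. Qed.
Let A1_inj x y : A1 x = A1 y -> x = y.
Proof. by move/eqP; rewrite -subr_eq0 -A1B => /eqP/inj1/eqP; rewrite subr_eq0 => /eqP. Qed.

Let ker0 : [set u | koszul0 A1 A2 u = 0] = [set 0].
Proof.
apply/seteqP; split=> [u [/inj1 //]|u ->].
by rewrite /= /koszul0 A10 A20.
Qed.

Lemma koszul_exact_range : koszul_exact A1 A2 ->
  forall y, exists p q, y = A1 p - A2 q.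
Proof.
move=> [_ _ onto] y; have : [set: H] y by [].
by rewrite onto => -[[q p] _ <-]; exists p, q.
Qed.

(** For injective A1, a cycle (p1, p2) with p1 = A1 u is the boundary of u, since
    A1 p2 = A2 A1 u = A1 A2 u. So the middle homology is the kernel of A2 on the
    quotient by the range of A1, and the last one is its cokernel. *)
Lemma koszul_exactI :
    (forall x z, A2 x = A1 z -> exists x', x = A1 x') ->
    (forall y, exists p q, y = A1 p - A2 q) ->
  koszul_exact A1 A2.
Proof.
move=> h1 h2; split=> //.
  apply/seteqP; split=> [[p1 p2] /eqP|_ [u _ <-]]; last first.
    by rewrite /= /koszul1 /= comm subrr.
  rewrite /koszul1 subr_eq0 /= => /eqP p12.
  have [u p1E] := h1 _ _ (esym p12).
  exists u => //; rewrite /koszul0 -p1E; congr pair; apply: A1_inj.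
  by rewrite comm p12 p1E.
apply/seteqP; split=> // y _; have [p [q ->]] := h2 y.
by exists (q, p).
Qed.

Lemma koszul_exact_onto1 : (forall y, exists p, A1 p = y) -> koszul_exact A1 A2.
Proof.
move=> onto1; apply: koszul_exactI => [x _ _|y].
  by have [p <-] := onto1 x; exists p.
by have [p <-] := onto1 y; exists p, 0; rewrite A20 subr0.
Qed.

Lemma koszul_exact_onto2 : (forall x, A2 x = 0 -> x = 0) ->
  (forall y, exists p, A2 p = y) -> koszul_exact A1 A2.
Proof.
move=> inj2 onto2; apply: koszul_exactI => [x z|y].
  have [u <-] := onto2 z; rewrite comm => /eqP; rewrite -subr_eq0 -A2B.
  by move=> /eqP/inj2/eqP; rewrite subr_eq0 => /eqP ->; exists u.
by have [p pE] := onto2 (- y); exists 0, p; rewrite A10 sub0r pE opprK.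
Qed.

Let vsubspace_range1 : vsubspace (range A1).
Proof.
split; first by exists 0.
by move=> a _ _ [x _ <-] [y _ <-]; exists (a *: x + y).
Qed.

Let vsubspace_koszul1 : vsubspace (range (koszul1 A1 A2)).
Proof.
split; first by exists (0, 0); rewrite // /koszul1 /= A10 A20 subrr.
move=> a _ _ [x _ <-] [y _ <-]; exists (a *: x + y) => //.
by rewrite /koszul1 /= lin1 lin2 scalerBr opprD addrACA.
Qed.

(** Again (p1, p2) |-> p1 embeds the middle homology into the quotient by the
    range of A1. *)
Lemma koszul_fredholmI :
    spanned_mod [set x | exists z, A2 x = A1 z] (range A1) ->
    spanned_mod setT (range (koszul1 A1 A2)) ->
  koszul_fredholm A1 A2.
Proof.
move=> h1 h2; split.
- exists 0%N, (fun=> 0); split=> [[]//|z /=].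
  rewrite -[koszul0 _ _ z = 0]/([set u | koszul0 A1 A2 u = 0] z) ker0 => ->.
  by exists (fun=> 0); rewrite big_ord0 subr0.
- have [||| n [v [vZ vP]]] := @fin_dim_quotient_spanned _ _ _ _ _ _ _ h1 => //.
  + split; first by exists 0; rewrite A10 A20.
    move=> a x y [z xz] [z' yz']; exists (a *: z + z').
    by rewrite lin1 lin2 xz yz'.
  + by move=> _ [x _ <-]; exists (A2 x); rewrite comm.
  have [w wP] := choice vZ.
  exists n, (fun i => (v i, w i)); split=> [i /=|[p1 p2]].
    by rewrite /koszul1 /= wP subrr.
  rewrite /koszul1 /= => /eqP; rewrite subr_eq0 => /eqP p12.
  have [|a [u _ ua]] := vP p1; first by exists p2.
  exists a, u => //.
  have -> : \sum_(i < n) a i *: (v i, w i) =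
      (\sum_(i < n) a i *: v i, \sum_(i < n) a i *: w i).
    by elim/big_rec3: _ => // i x y z _ ->.
  rewrite /koszul0 ua; congr pair; apply: A1_inj.
  have sumA (F G : 'I_n -> H) : (forall i, A2 (F i) = A1 (G i)) ->
      A1 (\sum_(i < n) a i *: G i) = A2 (\sum_(i < n) a i *: F i).
    move=> FG; elim/big_rec2: _ => [|i x y _ xy]; first by rewrite A10 A20.
    by rewrite lin1 lin2 xy FG.
  rewrite comm ua A1B A2B p12; congr (_ - _); exact/esym/sumA.
- exact: fin_dim_quotient_spanned.
Qed.

Lemma koszul_fredholm_range1 :
  spanned_mod setT (range A1) -> koszul_fredholm A1 A2.
Proof.
move=> h; apply: koszul_fredholmI; first exact: spanned_mod_sub h.
apply: spanned_mod_sub h => // _ [p _ <-]; exists (0, p) => //.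
by rewrite /koszul1 /= A20 subr0.
Qed.

Lemma koszul_exact_fredholm : koszul_exact A1 A2 -> koszul_fredholm A1 A2.
Proof.
move=> [_ h1 h2]; apply: koszul_fredholmI; last first.
  by rewrite -h2; exact: sub_spanned_mod.
apply: sub_spanned_mod => x [z xz].
have : [set p | koszul1 A1 A2 p = 0] (x, z) by rewrite /= /koszul1 /= xz subrr.
by rewrite h1 => -[u _ [<- _]]; exists u.
Qed.
End KoszulPair.

(** * The inner product *)

Section DotProduct.
Variables (R : realType) (I : choiceType).
Notation V := (ell2_type R I).
Implicit Types u v x y : V.

Lemma ell2_dot_linear a x y v :
  ell2_dot (a *: x + y) v = a * ell2_dot x v + ell2_dot y v.
Proof. exact: ell2_dotP. Qed.

Lemma ell2_dot_conj u v : ell2_dot u v = (ell2_dot v u)^*.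
Proof. by rewrite ell2_dotC expr0 mul1r. Qed.

Lemma ell2_dot0l v : ell2_dot 0 v = 0.
Proof. by have := ell2_dot_linear (- 1) 0 0 v; rewrite scaler0 addr0 mulN1r addNr. Qed.

Lemma ell2_dotDl x y v : ell2_dot (x + y) v = ell2_dot x v + ell2_dot y v.
Proof. by rewrite -[x in LHS]scale1r ell2_dot_linear mul1r. Qed.

Lemma ell2_dotZl a x v : ell2_dot (a *: x) v = a * ell2_dot x v.
Proof. by rewrite -[_ *: _]addr0 ell2_dot_linear ell2_dot0l addr0. Qed.

Lemma ell2_dotBl x y v : ell2_dot (x - y) v = ell2_dot x v - ell2_dot y v.
Proof. by rewrite -scaleN1r ell2_dotDl ell2_dotZl mulN1r. Qed.

Lemma ell2_dotDr v x y : ell2_dot v (x + y) = ell2_dot v x + ell2_dot v y.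
Proof. by rewrite !(ell2_dot_conj v) ell2_dotDl -rmorphD. Qed.

Lemma ell2_dotZr a v x : ell2_dot v (a *: x) = a^* * ell2_dot v x.
Proof. by rewrite !(ell2_dot_conj v) ell2_dotZl -rmorphM. Qed.

Lemma ell2_dotBr v x y : ell2_dot v (x - y) = ell2_dot v x - ell2_dot v y.
Proof. by rewrite !(ell2_dot_conj v) ell2_dotBl -rmorphB. Qed.

Lemma ell2_dot_suml (F : nat -> V) n v :
  ell2_dot (\sum_(i < n) F i) v = \sum_(i < n) ell2_dot (F i) v.
Proof.
elim: n => [|n IH]; first by rewrite !big_ord0 ell2_dot0l.
by rewrite !big_ord_recr /= ell2_dotDl IH.
Qed.

Lemma ell2_dot_sqr u : ell2_dot u u = (ell2_norm u ^+ 2)%:C.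
Proof. by rewrite ell2_dotE rmorphXn. Qed.

Lemma ell2_dot_disjoint u v : (forall i, u i * (v i)^* = 0) -> ell2_dot u v = 0.
Proof.
move=> uv; rewrite /ell2_dot (_ : (fun i => _) = fun=> 0); last exact/funext.
have s0 : ssum (fun _ : I => (0 : R)) = 0%E by rewrite /ssum esum1.
rewrite /csum /= /rsum.
have f0 : (fun _ : I => (0 : R))^\+%R = fun=> 0.
  by apply/funext => i; rewrite /funrpos max_l.
have f1 : (fun _ : I => (0 : R))^\-%R = fun=> 0.
  by apply/funext => i; rewrite /funrneg oppr0 max_l.
by rewrite f0 f1 s0 subrr.
Qed.

Lemma ell2_CauchySchwarz u v :
  normc (ell2_dot u v) <= ell2_norm u * ell2_norm v.
Proof.
have [v0|vn0] := eqVneq (ell2_norm v) 0.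
  rewrite (ell2_norm_eq0 v0) ell2_norm0 mulr0.
  by rewrite ell2_dot_conj ell2_dot0l conjC0 normc0.
set s := ell2_dot u v; set b := ell2_norm v.
have b0 : b ^+ 2 != 0 by rewrite expf_neq0.
have bc : (b ^+ 2)%:C != 0 :> R[i] by rewrite fmorph_eq0.
pose t := s / (b ^+ 2)%:C.
have st : s * s^* = (normc s ^+ 2)%:C by rewrite -normCK norm_normc rmorphXn.
have := ell2_dot_sqr (u - t *: v).
rewrite ell2_dotBl !ell2_dotBr !ell2_dotZl !ell2_dotZr -/s (ell2_dot_conj v u) -/s.
rewrite !ell2_dot_sqr -/b.
have tc : t^* = s^* / (b ^+ 2)%:C.
  by rewrite /t rmorphM fmorphV; congr (_ / _); exact: conjc_real.
have -> : (ell2_norm u ^+ 2)%:C - t^* * s - (t * s^* - t * (t^* * (b ^+ 2)%:C)) =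
   (ell2_norm u ^+ 2 - normc s ^+ 2 / b ^+ 2)%:C.
  rewrite real_complexB (real_complexM _ (_^-1)) real_complexV -st tc /t.
  by move: bc; move: ((b ^+ 2)%:C) => bb bb0; field.
move=> /complexI E; have := sqr_ge0 (ell2_norm (u - t *: v)); rewrite -E.
rewrite subr_ge0 ler_pdivrMr; last by rewrite lt_def b0 sqr_ge0.
by rewrite -exprMn ler_sqr ?nnegrE ?mulr_ge0 ?ell2_norm_ge0 ?normc_ge0.
Qed.
End DotProduct.

(** * A criterion against the Fredholm property *)

Section ApproximateKernel.
Variables (R : realType) (I : choiceType) (rank : I -> nat).
Notation V := (ell2_type R I).
Variables A1 A2 : V -> V.

(** Up to e, y is orthogonal to the ranges of A1 and A2, that is, a joint
    approximate null vector of the adjoints. The bounds m, n on its support leave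
    room for further such vectors with disjoint supports. *)
Definition almost_orthogonal (e : R) (m n : nat) (y : V) : Prop :=
  [/\ y != 0, forall i, y i != 0 -> (m <= rank i < n)%N,
      forall p, normc (ell2_dot (A1 p) y) <= e * ell2_norm p * ell2_norm y &
      forall p, normc (ell2_dot (A2 p) y) <= e * ell2_norm p * ell2_norm y].

Hypothesis approx : forall e m, 0 < e -> exists n y, almost_orthogonal e m n y.

(** Two vectors with disjoint supports can be combined to be orthogonal to one
    more prescribed vector, at the price of doubling the error. *)
Lemma almost_orthogonal_avoid k (v : 'I_k -> V) e m : 0 < e ->
  exists n y, almost_orthogonal e m n y /\ forall i, ell2_dot (v i) y = 0.
Proof.
elim: k v e m => [|k IH] v e m e0.
  by have [n [y H]] := approx m e0; exists n, y; split=> // -[].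
have e20 : 0 < e / 2 by rewrite divr_gt0.
pose v' (i : 'I_k) := v (widen_ord (leqnSn k) i).
have split_ord (P : 'I_k.+1 -> Prop) : P ord_max ->
    (forall i : 'I_k, P (widen_ord (leqnSn k) i)) -> forall i, P i.
  move=> Pm Pw i; have [->//|im] := eqVneq i ord_max.
  have ik : (i < k)%N.
    by rewrite ltn_neqAle -ltnS ltn_ord andbT; apply: contra im => /eqP ?; apply/eqP/val_inj.
  by rewrite (_ : i = widen_ord (leqnSn k) (Ordinal ik)) //; exact/val_inj.
have [n [y [[y0 ys y1 y2] vy]]] := IH v' (e / 2) m e20.
have [n' [z [[z0 zs z1 z2] vz]]] := IH v' (e / 2) (maxn m n) e20.
pose s := ell2_dot (v ord_max) y; pose t := ell2_dot (v ord_max) z.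
have half (x : R) : 0 <= x -> e / 2 * x <= e * x.
  by move=> x0; rewrite ler_wpM2r// ler_pdivrMr// ler_pMr// ler1n.
have [s0|sn0] := eqVneq s 0.
  exists n, y; split; last by apply: split_ord => // i; exact: vy.
  by split=> // p; [have := y1 p|have := y2 p]; move=> /le_trans; apply;
    rewrite -[leLHS]mulrA -[leRHS]mulrA half// mulr_ge0// ell2_norm_ge0.
(* the coefficients solve conj(a) s + conj(b) t = 0 *)
pose a := t^*; pose b := - s^*.
pose x : V := a *: y + b *: z.
have yz i : y i = 0 \/ z i = 0.
  have [->|/ys /andP[_ yn]] := eqVneq (y i) 0; first by left.
  have [->|/zs /andP[zn _]] := eqVneq (z i) 0; first by right.
  by move: zn; rewrite geq_max => /andP[_]; rewrite leqNgt yn.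
have xy : normc a * ell2_norm y <= ell2_norm x.
  rewrite -ell2_normZ -[leRHS]mul1r; apply: ell2_norm_le => // i.
  rewrite mul1r !ell2E; case: (yz i) => ->; first by rewrite mulr0 normc0 normc_ge0.
  by rewrite mulr0 addr0.
have xz : normc b * ell2_norm z <= ell2_norm x.
  rewrite -ell2_normZ -[leRHS]mul1r; apply: ell2_norm_le => // i.
  rewrite mul1r !ell2E; case: (yz i) => ->; last by rewrite mulr0 normc0 normc_ge0.
  by rewrite mulr0 add0r.
have bn0 : b != 0 by rewrite oppr_eq0 conjC_eq0.
have combine (A : V -> V) p :
    normc (ell2_dot (A p) y) <= e / 2 * ell2_norm p * ell2_norm y ->
    normc (ell2_dot (A p) z) <= e / 2 * ell2_norm p * ell2_norm z ->
    normc (ell2_dot (A p) x) <= e * ell2_norm p * ell2_norm x.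
  move=> Ay Az; rewrite ell2_dotDr !ell2_dotZr; apply: le_trans (normcD _ _) _.
  rewrite !normcM (normcJ a) (normcJ b).
  have h1 := ler_wpM2l (normc_ge0 a) Ay; have h2 := ler_wpM2l (normc_ge0 b) Az.
  have p0 : 0 <= e / 2 * ell2_norm p by rewrite mulr_ge0 ?ell2_norm_ge0// ltW.
  have h3 := ler_wpM2l p0 xy; have h4 := ler_wpM2l p0 xz.
  by lra.
exists (maxn n n'), x; split; last first.
  apply: split_ord => [|i]; rewrite ell2_dotDr !ell2_dotZr.
    rewrite -/s -/t /a /b rmorphN /= !conjCK mulNr.
    by rewrite mulrC subrr.
  by rewrite [ell2_dot _ y]vy [ell2_dot _ z]vz !mulr0 addr0.
split=> [||p|p]; last 2 first.
- exact: combine.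
- exact: combine.
- apply/eqP => x0; move: xz; rewrite x0 ell2_norm0 => bz.
  have := mulr_ge0 (normc_ge0 b) (ell2_norm_ge0 z).
  move=> bz0; have /eqP : normc b * ell2_norm z = 0 by apply/eqP; rewrite eq_le bz.
  rewrite mulf_eq0 normc_eq0 (negbTE bn0) /= => /eqP/ell2_norm_eq0 zz.
  by move: z0; rewrite zz eqxx.
- move=> i; rewrite !ell2E => xi.
  have [yi|/ys /andP[mi ni]] := eqVneq (y i) 0; last by rewrite mi leq_max ni.
  move: xi; rewrite yi mulr0 add0r mulf_eq0 negb_or => /andP[_ /zs /andP[mi ni]].
  by rewrite (leq_trans (leq_maxl _ _) mi) leq_max ni orbT.
Qed.

(** Gliding hump. Suppose that v_1, ..., v_k span modulo the range. Take y_j with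
    disjoint supports, orthogonal to all v_i, with errors 4^-j. Pairing
    z = sum_j 2^-j y_j / |y_j| with y_j gives 2^-j |y_j|, while every element
    A1 p - A2 q + sum_i a_i v_i pairs with y_j to O(4^-j) |y_j|. *)
Lemma almost_orthogonal_not_fredholm : ~ koszul_fredholm A1 A2.
Proof.
move=> [_ _ [k [v [_ vP]]]].
pose half : R := 2^-1.
have half0 : 0 < half by rewrite invr_gt0.
have half1 : half < 1 by rewrite invf_lt1// ltr1n.
have half01 : 0 <= half < 1 by rewrite ltW.
have pick (jm : nat * nat) : exists ny : nat * V,
    almost_orthogonal (half ^+ jm.1 * half ^+ jm.1) jm.2 ny.1 ny.2 /\
    forall i, ell2_dot (v i) ny.2 = 0.
  have [|n [y ?]] := @almost_orthogonal_avoid k v (half ^+ jm.1 * half ^+ jm.1) jm.2.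
    by rewrite mulr_gt0// exprn_gt0.
  by exists (n, y).
have [F FP] := choice pick.
pose pos := fix pos j := if j is j'.+1 then (F (j', pos j')).1 else 0%N.
pose y j := (F (j, pos j)).2.
have yP j : almost_orthogonal (half ^+ j * half ^+ j) (pos j) (pos j.+1) (y j).
  by have [] := FP (j, pos j).
have vy j i : ell2_dot (v i) (y j) = 0 by have [_] := FP (j, pos j); apply.
have y0 j : ell2_norm (y j) != 0.
  have [yj0 _ _ _] := yP j; apply/eqP => /ell2_norm_eq0 yj.
  by rewrite yj eqxx in yj0.
have posS j : (pos j < pos j.+1)%N.
  have [yj0 ys _ _] := yP j.
  have [i yi] : exists i, y j i != 0.
    apply: contrapT => H; move/eqP: yj0; apply; apply: ell2P => i.
    by apply/eqP/negPn/negP => yi; apply: H; exists i.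
  by have /andP[a1 a2] := ys i yi; exact: leq_ltn_trans a1 a2.
have pos_mono i j : (i <= j)%N -> (pos i <= pos j)%N.
  elim: j => [|j IH]; first by rewrite leqn0 => /eqP ->.
  rewrite leq_eqVlt => /orP[/eqP ->//|]; rewrite ltnS => /IH /leq_trans; apply.
  exact: ltnW.
have orth i j : i != j -> ell2_dot (y i) (y j) = 0.
  move=> ij; apply: ell2_dot_disjoint => a; apply/eqP; rewrite mulf_eq0 conjC_eq0.
  apply/negPn/negP; rewrite negb_or => /andP[yi yj].
  have [_ /(_ _ yi)/andP[a1 a2] _ _] := yP i.
  have [_ /(_ _ yj)/andP[b1 b2] _ _] := yP j.
  have [lt_ij|lt_ji|/eqP] := ltngtP i j; last by rewrite (negbTE ij).
    by move: (leq_trans a2 (pos_mono _ _ lt_ij)); rewrite ltnNge b1.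
  by move: (leq_trans b2 (pos_mono _ _ lt_ji)); rewrite ltnNge a1.
pose u j : V := (half ^+ j / ell2_norm (y j))%:C *: y j.
have [|z zP] := @ell2_geometric_series _ _ u 1 half half01.
  move=> j; rewrite ell2_normZ normc_realE ger0_norm ?divfK ?mul1r//.
  by rewrite divr_ge0 ?ell2_norm_ge0 ?exprn_ge0 ?ltW.
have zy j : half ^+ j * ell2_norm (y j) <= normc (ell2_dot z (y j)).
  apply/ler_addgt0Pr => e e0.
  pose K := 1 / (1 - half) * ell2_norm (y j).
  have K0 : 0 < K + 1.
    by rewrite ltr_wpDl// mulr_ge0 ?ell2_norm_ge0// divr_ge0// subr_ge0 ltW.
  have [|n nP] := @expr_lt_small _ half (e / (K + 1)) half01; first by rewrite divr_gt0.
  pose N := maxn n j.+1.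
  have jN : (j < N)%N by rewrite leq_max leqnn orbT.
  pose S : V := \sum_(i < N) u i.
  have Sy : ell2_dot S (y j) = (half ^+ j * ell2_norm (y j))%:C.
    rewrite ell2_dot_suml (bigD1 (Ordinal jN))//= big1 ?addr0; last first.
      by move=> i ij; rewrite ell2_dotZl orth ?mulr0.
    rewrite ell2_dotZl ell2_dot_sqr -rmorphM; congr (_%:C).
    by field; exact: y0.
  have E : (half ^+ j * ell2_norm (y j))%:C = ell2_dot z (y j) - ell2_dot (z - S) (y j).
    by rewrite ell2_dotBl Sy opprB addrC subrK.
  have -> : half ^+ j * ell2_norm (y j) = normc ((half ^+ j * ell2_norm (y j))%:C).
    by rewrite normc_realE ger0_norm// mulr_ge0 ?ell2_norm_ge0 ?exprn_ge0 ?ltW.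
  rewrite E; apply: le_trans (normcD _ _) _; rewrite lerD2l normcNz.
  apply: le_trans (ell2_CauchySchwarz _ _) _.
  apply: le_trans (ler_wpM2r (ell2_norm_ge0 _) (zP N)) _.
  rewrite mulrAC -/K; have := nP N (leq_maxl _ _).
  rewrite ltr_pdivlMr// mulrC => /ltW; apply: le_trans.
  by rewrite ler_wpM2r ?exprn_ge0 ?lerDl// ltW.
have [a [[q p] _ zE]] := vP z Logic.I.
pose C := ell2_norm p + ell2_norm q.
have C0 : 0 <= C by rewrite addr_ge0 ?ell2_norm_ge0.
have zy2 j : normc (ell2_dot z (y j)) <= half ^+ j * half ^+ j * C * ell2_norm (y j).
  have -> : ell2_dot z (y j) = ell2_dot (A1 p) (y j) - ell2_dot (A2 q) (y j).
    rewrite -ell2_dotBl -[A1 p - A2 q]/(koszul1 A1 A2 (q, p)) zE ell2_dotBl.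
    rewrite [X in _ - X](_ : _ = 0) ?subr0//.
    elim/big_ind: _ => [|x1 x2 h1 h2|i _]; first exact: ell2_dot0l.
      by rewrite ell2_dotDl h1 h2 addr0.
    by rewrite ell2_dotZl vy mulr0.
  apply: le_trans (normcD _ _) _; rewrite normcNz.
  have [_ _ /(_ p) h1 /(_ q) h2] := yP j.
  by rewrite /C mulrDr mulrDl lerD.
have [|n /(_ n (leqnn n))] := @expr_lt_small _ half (C + 1)^-1 half01.
  by rewrite invr_gt0 ltr_wpDl.
have := le_trans (zy n) (zy2 n).
have yn : 0 < ell2_norm (y n) by rewrite lt_def y0 ell2_norm_ge0.
rewrite ler_pM2r// -mulrA -[leLHS]mulr1 ler_pM2l ?exprn_gt0// => h.
rewrite -[ltRHS]mul1r ltr_pdivlMr ?ltr_wpDl// mulrDr mulr1.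
have := exprn_gt0 n half0; lra.
Qed.
End ApproximateKernel.

(** * Tensor products and adjoints *)

Section Tensor.
Variables (R : realType) (I J : choiceType).

Lemma sqsum_tensor (u : I -> R[i]) (g : J -> R[i]) :
    sqsum g \is a fin_num ->
  sqsum (fun p : I * J => u p.1 * g p.2) = (sqsum u * sqsum g)%E.
Proof.
move=> gfin; rewrite /sqsum /ssum.
have -> : [set: I * J] = [set: I] `*`` (fun=> [set: J]).
  by apply/seteqP; split.
rewrite -(@esum_esum _ _ _ setT (fun=> setT)
  (fun i j => ((normc (u i * g j)) ^+ 2)%:E)); last first.
  by move=> i j _ _; rewrite lee_fin sqr_ge0.
have gE : sqsum g = (fine (sqsum g))%:E by rewrite fineK.
rewrite -!/(ssum _) -/(sqsum u) -/(sqsum g) gE muleC.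
rewrite -ssumZ; last 2 first.
- by rewrite fine_ge0// sqsum_ge0.
- by move=> i; rewrite sqr_ge0.
apply: eq_esum => i _; rewrite mulrC EFinM -gE.
rewrite -ssumZ ?sqr_ge0//; last by move=> j; rewrite sqr_ge0.
by apply: eq_esum => j _; rewrite normcM exprMn.
Qed.

Definition tensor (u : ell2_type R I) (g : ell2_type R J) :
  ell2_type R (I * J)%type := ell2_of (fun p => u p.1 * g p.2).

Lemma tensorE u g p : tensor u g p = u p.1 * g p.2.
Proof.
apply: ell2_ofE; rewrite unfold_in sqsum_tensor ?sqsum_fin_num//.
by rewrite !sqsum_normE -EFinM ltry.
Qed.

Lemma ell2_norm_tensor u g :
  ell2_norm (tensor u g) = ell2_norm u * ell2_norm g.
Proof.
apply/eqP; rewrite -(@eqrXn2 _ 2)// ?mulr_ge0 ?ell2_norm_ge0//.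
rewrite -eqe -sqsum_normE exprMn EFinM -!sqsum_normE -sqsum_tensor ?sqsum_fin_num//.
by apply/eqP; congr (sqsum _); apply/funext => p; rewrite tensorE.
Qed.

Lemma tensor_neq0 u g : u != 0 -> g != 0 -> tensor u g != 0.
Proof.
move=> u0 g0; apply/eqP => y0; have := ell2_norm_tensor u g; rewrite y0 ell2_norm0.
move/esym/eqP; rewrite mulf_eq0 => /orP[] /eqP/ell2_norm_eq0 E.
  by rewrite E eqxx in u0.
by rewrite E eqxx in g0.
Qed.
End Tensor.

Section Adjoint.
Variables (R : realType) (I : choiceType).
Notation V := (ell2_type R I).

Lemma ell2_dot_delta (x : V) i : ell2_dot x (ell2_delta R i) = x i.
Proof.
pose y : V := x - x i *: ell2_delta R i.
have yd : ell2_dot y (ell2_delta R i) = 0.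
  apply: ell2_dot_disjoint => j; rewrite !ell2E; case: eqP => [->|_].
    by rewrite mulr1 subrr mul0r.
  by rewrite conjC0 mulr0.
have -> : x = y + x i *: ell2_delta R i by rewrite subrK.
rewrite ell2_dotDl yd add0r ell2_dotZl ell2_dot_sqr ell2_norm_delta expr1n mulr1.
by rewrite !ell2E eqxx mulr1 subrr add0r.
Qed.

Definition adjoint_pair (T S : V -> V) :=
  forall x y, ell2_dot (T x) y = ell2_dot x (S y).

Lemma adjoint_shift_coord (f : I -> I) (a : I -> R) (T : {linear V -> V})
    (S : V -> V) (y : V) i :
  index_shift f a T -> adjoint_pair T S -> S y i = (a i)%:C * y (f i).
Proof.
move=> [_ _ Td] TS.
have := TS (ell2_delta R i) y.
rewrite Td ell2_dotZl !(ell2_dot_conj (ell2_delta _ _)) !ell2_dot_delta => E.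
have := congr1 (fun z => z^*) E; rewrite rmorphM !conjCK => <-.
congr (_ * _); [exact: conjc_real|exact: conjCK].
Qed.

Lemma adjoint_pair_bound (T S : V -> V) (lam : R[i]) (e : R) (y : V) :
    adjoint_pair T S -> ell2_norm (S y - lam^* *: y) <= e * ell2_norm y ->
  forall p, normc (ell2_dot (sub_scalar T lam p) y) <= e * ell2_norm p * ell2_norm y.
Proof.
move=> TS Sy p; rewrite /sub_scalar ell2_dotBl TS ell2_dotZl.
have -> : lam * ell2_dot p y = ell2_dot p (lam^* *: y).
  by rewrite ell2_dotZr conjCK.
rewrite -ell2_dotBr; apply: le_trans (ell2_CauchySchwarz _ _) _.
by rewrite mulrAC -[leRHS]mulrC ler_wpM2l ?ell2_norm_ge0.
Qed.
End Adjoint.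

(** * Approximate eigenvectors of backward shifts *)

Section ApproximateEigenvectors.
Variable R : realType.
Notation V := (ell2_type R nat).

Definition tends_to (v : nat -> R) (b : R) :=
  forall e, 0 < e -> exists n, forall m, (n <= m)%N -> `|v m - b| < e.

Lemma ratio_tends_to0 (x : nat -> R) (q : R) n0 : 0 <= q < 1 ->
    (forall n, 0 <= x n) -> (forall n, (n0 <= n)%N -> x n.+1 <= q * x n) ->
  tends_to x 0.
Proof.
move=> q01 x0 xq e e0; have /andP[q0 _] := q01.
have bound d : x (n0 + d)%N <= x n0 * q ^+ d.
  elim: d => [|d IH]; first by rewrite addn0 expr0 mulr1.
  rewrite addnS; apply: le_trans (xq _ (leq_addr _ _)) _.
  by rewrite exprS mulrCA ler_wpM2l.
have K0 : 0 < x n0 + 1 by rewrite ltr_wpDl.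
have [|n nP] := @expr_lt_small _ q (e / (x n0 + 1)) q01; first by rewrite divr_gt0.
exists (n0 + n)%N => m nm; rewrite subr0 ger0_norm//.
have n0m : (n0 <= m)%N by exact: leq_trans (leq_addr _ _) nm.
rewrite -(subnKC n0m); apply: le_lt_trans (bound _) _.
have := nP (m - n0)%N; rewrite leq_subRL// => /(_ nm).
rewrite ltr_pdivlMr// mulrC; apply: le_lt_trans.
by rewrite ler_wpM2r ?exprn_ge0// lerDl.
Qed.

Definition window (h : nat -> R[i]) (m n : nat) : V :=
  \sum_(m <= i < n) h i *: ell2_delta R i.

Lemma windowS h m n : (m <= n)%N ->
  window h m n.+1 = window h m n + h n *: ell2_delta R n.
Proof. by move=> mn; rewrite /window big_nat_recr. Qed.

Lemma windowE h m n i : window h m n i = if (m <= i < n)%N then h i else 0.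
Proof.
elim: n => [|n IH]; first by rewrite /window big_geq// ltn0 andbF.
have [mn|nm] := leqP m n; last first.
  rewrite /window big_geq// ell2E; case: ifP => // /andP[mi]; rewrite ltnS => i_n.
  by move: nm; rewrite ltnNge (leq_trans mi i_n).
rewrite windowS// ell2E IH !ell2E ltnS.
have [->|i_n] := eqVneq i n; first by rewrite ltnn leqnn mn andbF mulr1 add0r.
by rewrite mulr0 addr0 [(i <= n)%N]leq_eqVlt (negbTE i_n).
Qed.

Lemma window_sqr_norm h m n : (m <= n)%N -> (forall i, normc (h i) = 1) ->
  ell2_norm (window h m n) ^+ 2 = (n - m)%:R.
Proof.
move=> + h1; elim: n => [|n IH].
  by rewrite leqn0 => /eqP ->; rewrite /window big_geq// ell2_norm0 expr0n subnn.
rewrite leq_eqVlt => /orP[/eqP ->|].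
  by rewrite /window big_geq// ell2_norm0 expr0n subnn.
rewrite ltnS => mn; rewrite subSn// -natr1 -IH//.
rewrite windowS//.
apply: complexI; rewrite -[LHS]ell2_dot_sqr ell2_dotDl !ell2_dotDr.
have d0 : ell2_dot (window h m n) (h n *: ell2_delta R n) = 0.
  apply: ell2_dot_disjoint => i; rewrite windowE !ell2E.
  case: eqP => [->|_]; first by rewrite ltnn andbF mul0r.
  by rewrite mulr0 conjC0 mulr0.
rewrite d0 (ell2_dot_conj (h n *: _)) d0 conjC0 addr0 add0r !ell2_dot_sqr.
by rewrite ell2_normZ h1 mul1r ell2_norm_delta expr1n rmorphD.
Qed.

(** On the boundary circle, a long window of a pure oscillation far out is an
    approximate eigenvector of the backward shift: only its ends contribute
    more than the deviation of the weights from their limit. *)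
Lemma backward_shift_far (v : nat -> R) (b : R) (mu : R[i]) (e : R) (m : nat) :
    tends_to v b -> 0 < b -> normc mu = b -> 0 < e ->
  exists n (u r : V), [/\ u != 0, forall i, u i != 0 -> (m <= i < n)%N,
    forall i, r i = (v i)%:C * u i.+1 - mu * u i &
    ell2_norm r <= e * ell2_norm u].
Proof.
move=> vb b0 mub e0.
have [|n0 vn0] := vb (Num.min 1 (e / 2)).
  by rewrite lt_min ltr01 divr_gt0.
pose m1 := maxn m n0.
pose p := mu / b%:C; pose h i := p ^+ i.
have bC : b%:C != 0 :> R[i] by rewrite fmorph_eq0 gt_eqF.
have h1 i : normc (h i) = 1.
  by rewrite normcX normcM normcV normc_realE gtr0_norm// mub divff ?expr1n// gt_eqF.
pose K := 2 * (2 * b + 1) / e.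
have K0 : 0 <= K by rewrite divr_ge0 ?(ltW e0)//; lra.
pose L := (Num.trunc (K ^+ 2)).+1.
pose m2 := m1.+1; pose n := (m2 + L)%N.
pose u := window h m2 n.
have m2n : (m2 <= n)%N by rewrite leq_addr.
have uE i : u i = if (m2 <= i < n)%N then h i else 0 by exact: windowE.
have uK : K < ell2_norm u.
  rewrite -ltr_sqr ?nnegrE ?ell2_norm_ge0// window_sqr_norm// addKn.
  by have := truncnS_gt (K ^+ 2); rewrite /L.
pose r_in : V := window (fun i => ((v i - b)%:C * h i.+1)) m2 n.-1.
pose r : V := ((v m1)%:C * h m2) *: ell2_delta R m1 - (mu * h n.-1) *: ell2_delta R n.-1
   + r_in.
have n1 : n.-1.+1 = n by rewrite prednK// /n addnS.
have m1n : (m1 < n.-1.+1)%N by rewrite n1.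
exists n, u, r; split.
- by apply/eqP => u0; move: uK; rewrite u0 ell2_norm0 ltNge K0.
- move=> i; rewrite uE; case: ifP; rewrite ?eqxx// => /andP[mi ->] _.
  by rewrite andbT (leq_trans _ mi)// leqW// leq_maxl.
- move=> i; rewrite !ell2E windowE !uE.
  have hS : h i.+1 * b%:C = mu * h i by rewrite /h exprS /p; field.
  have [im1|im1] := eqVneq i m1.
    have -> : (i == n.-1) = false.
      by apply/negbTE; rewrite im1 neq_ltn /n /m2 /L; apply/orP; left; lia.
    rewrite im1 ltnn /= leqnn.
    have -> : (m1.+1 < n)%N by rewrite /n /m2 /L; lia.
    by rewrite !mulr1 !mulr0 subr0 addr0.
  rewrite mulr0 add0r.
  have [im2|im2] := ltnP i m2.
    have -> : (m2 <= i.+1)%N = false by apply/negbTE; move: im1 im2; rewrite /m2; lia.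
    have -> : (i == n.-1) = false by apply/negbTE; rewrite /n /L; move: im2; lia.
    by rewrite !mulr0 subr0 oppr0 addr0.
  rewrite (leqW im2) /=.
  have [iLn|iLn|iLn] := ltngtP i n.-1.
  - have -> : (i < n)%N by rewrite -n1; lia.
    have -> : (i.+1 < n)%N by rewrite -n1; lia.
    by rewrite mulr0 oppr0 add0r real_complexB mulrBl [b%:C * _]mulrC hS.
  - have -> : (i < n)%N = false by apply/negbTE; rewrite -n1; lia.
    have -> : (i.+1 < n)%N = false by apply/negbTE; rewrite -n1; lia.
    by rewrite !mulr0 subr0 oppr0 addr0.
  - rewrite iLn n1 ltnn mulr1 addr0 mulr0 sub0r.
    by have -> : (n.-1 < n)%N by rewrite -[ltnRHS]n1.
- have vm1 : `|v m1 - b| < 1.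
    by have := vn0 m1 (leq_maxr _ _); rewrite lt_min => /andP[].
  have in_small : ell2_norm r_in <= e / 2 * ell2_norm u.
    apply: ell2_norm_le => [|i]; first by rewrite divr_ge0// ltW.
    rewrite windowE uE; case: ifPn => [/andP[mi i_n]|_]; last first.
      by rewrite normc0 mulr_ge0 ?normc_ge0// divr_ge0// ltW.
    have -> : (m2 <= i < n)%N by rewrite mi -n1 ltnS ltnW.
    rewrite normcM !h1 !mulr1 normc_realE ltW//.
    have := vn0 i; rewrite lt_min => /(_ _)/andP[]//.
    by rewrite (leq_trans _ mi)// leqW// leq_maxr.
  have ends : ell2_norm (((v m1)%:C * h m2) *: ell2_delta R m1 -
      (mu * h n.-1) *: ell2_delta R n.-1) <= 2 * b + 1.
    apply: le_trans (ell2_normB _ _) _.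
    rewrite !ell2_normZ !ell2_norm_delta !mulr1 !normcM !h1 !mulr1 normc_realE mub.
    have vm1' : `|v m1| <= b + 1.
      move: vm1; rewrite ltr_norml => /andP[? ?].
      by rewrite ler_norml; apply/andP; split; lra.
    by lra.
  apply: le_trans (ell2_normD _ _) _; apply: le_trans (lerD ends in_small) _.
  move: uK; rewrite /K ltr_pdivrMr// => uK; lra.
Qed.

(** Inside the disk the backward shift has honest eigenvectors; truncated, they
    are finitely supported with a single small error at the far end. Started
    at m, the error at m - 1 is left out. *)
Lemma backward_shift_eigen (v : nat -> R) (b : R) (mu : R[i]) (e : R) (m : nat) :
    tends_to v b -> (forall i, 0 < v i) -> normc mu < b -> 0 < e ->
  exists (u r : V), [/\ u != 0, forall i, (i < m)%N -> u i = 0 /\ r i = 0,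
    forall i, (m <= i)%N -> r i = (v i)%:C * u i.+1 - mu * u i,
    (mu = 0 -> forall i, u i != 0 -> i = m) &
    ell2_norm r <= e * ell2_norm u].
Proof.
move=> vb v0 mub e0.
pose h i := \prod_(m <= s < i) (mu / (v s)%:C).
have vC s : (v s)%:C != 0 :> R[i] by rewrite fmorph_eq0 gt_eqF.
have hm : h m = 1 by rewrite /h big_geq.
have hS i : (m <= i)%N -> (v i)%:C * h i.+1 = mu * h i.
  by move=> mi; rewrite /h big_nat_recr//= mulrC -mulrA divfK// mulrC.
pose q := (normc mu + b) / 2 .
have q0 : 0 < q by rewrite /q; have := normc_ge0 mu; lra.
have muq : normc mu < q by rewrite /q; lra.
have [|n0 vn0] := vb (b - q); first by rewrite /q; lra.
have [L hL] : exists L, (m <= L)%N /\ normc mu * normc (h L) <= e.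
  have xt : tends_to (fun i => normc (h i)) 0.
    apply: (@ratio_tends_to0 _ (normc mu / q) (maxn m n0)).
    - by rewrite divr_ge0 ?normc_ge0 ?(ltW q0)//= ltr_pdivrMr// mul1r.
    - by move=> n; exact: normc_ge0.
    - move=> n; rewrite geq_max => /andP[mn n0n].
      have := vn0 n n0n; rewrite ltr_norml => /andP[qv _].
      have {}qv : q <= v n by lra.
      have := congr1 (@normc R) (hS n mn); rewrite !normcM normc_realE gtr0_norm//.
      move=> E; rewrite mulrAC ler_pdivlMr// -E mulrC.
      by rewrite ler_wpM2r ?normc_ge0.
  have K0 : 0 < normc mu + 1 by rewrite ltr_wpDl ?normc_ge0.
  have [|n1 hn1] := xt (e / (normc mu + 1)); first by rewrite divr_gt0.
  exists (maxn m n1); split; first by rewrite leq_maxl.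
  have := hn1 (maxn m n1) (leq_maxr _ _).
  rewrite subr0 ger0_norm ?normc_ge0// ltr_pdivlMr// mulrC => /ltW; apply: le_trans.
  by rewrite ler_wpM2r ?normc_ge0// lerDl.
have [mL he] := hL.
pose u : V := window h m L.+1.
have uE i : u i = if (m <= i < L.+1)%N then h i else 0 by exact: windowE.
pose r : V := (- (mu * h L)) *: ell2_delta R L.
have um : u m = 1 by rewrite uE leqnn ltnS mL.
have u1 : 1 <= ell2_norm u.
  by have := ell2_norm_coord u m; rewrite um normc1.
exists u, r; split.
- by apply/eqP => u0; move: u1; rewrite u0 ell2_norm0 ler10.
- move=> i im; rewrite uE !ell2E leqNgt im; split=> //.
  have -> : (i == L) = false by apply/negbTE; rewrite neq_ltn (leq_trans im mL).
  by rewrite mulr0.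
- move=> i mi; rewrite !ell2E !uE mi (leqW mi) /= !ltnS.
  have [iL|iL|iL] := ltngtP i L; last 1 first.
  + by rewrite iL mulr1 mulr0 sub0r.
  + by rewrite mulr0 hS// subrr.
  + by rewrite !mulr0 subrr.
- move=> mu0 i; rewrite uE; case: ifP; rewrite ?eqxx// => /andP[mi _].
  have [->//|im] := eqVneq i m.
  have {mi im} : (m < i)%N by rewrite ltn_neqAle eq_sym im.
  by rewrite /h mu0 => mi; rewrite big_ltn// mul0r mul0r eqxx.
- rewrite /r ell2_normZ ell2_norm_delta mulr1 normcNz normcM.
  by apply: le_trans he _; rewrite ler_peMr// ltW.
Qed.
End ApproximateEigenvectors.

(** * Approximate joint eigenvectors of the adjoints *)

Definition step1 (p : nat * nat) : nat * nat := (p.1.+1, p.2).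
Definition step2 (p : nat * nat) : nat * nat := (p.1, p.2.+1).

Lemma step1_inj : injective step1. Proof. by move=> [i j] [i' j'] [-> ->]. Qed.
Lemma step2_inj : injective step2. Proof. by move=> [i j] [i' j'] [-> ->]. Qed.

Section JointApproximateEigenvectors.
Variable R : realType.
Notation V := (ell2_type R (nat * nat)%type).
Variables (alpha beta : nat -> nat -> R) (w : nat -> R).
Variables (T1 T2 : {linear V -> V}) (S1 S2 : V -> V).
Hypothesis sh1 : index_shift step1 (fun p => alpha p.1 p.2) T1.
Hypothesis sh2 : index_shift step2 (fun p => beta p.1 p.2) T2.
Hypothesis adj1 : adjoint_pair T1 S1.
Hypothesis adj2 : adjoint_pair T2 S2.
Variables (lam1 lam2 : R[i]).

(** Tensor an approximate eigenvector far to the right with one in the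
    vertical direction that starts in row m; what leaks into row m - 1 is
    controlled because the vertical weights there tend to 0. *)
Lemma almost_orthogonal_far_right (a : nat -> R) (b : R) (m : nat) :
    tends_to a b -> 0 < b -> normc lam1 = b ->
    ((0 < m)%N -> tends_to (beta^~ m.-1) 0) ->
    (forall e, 0 < e -> exists g r : ell2_type R nat, [/\
      g != 0 /\ (forall j, (j < m)%N -> g j = 0 /\ r j = 0),
      forall j, (m <= j)%N -> r j = (w j)%:C * g j.+1 - lam2^* * g j,
      forall i j, g j != 0 -> alpha i j = a i,
      forall i j, (m <= j)%N -> g j.+1 != 0 -> beta i j = w j &
      ell2_norm r <= e * ell2_norm g]) ->
  forall e N, 0 < e -> exists n y,
    almost_orthogonal fst (sub_scalar T1 lam1) (sub_scalar T2 lam2) e N n y.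
Proof.
move=> ab b0 lamb beta0 vert e N e0.
have e20 : 0 < e / 2 by rewrite divr_gt0.
have [g [r [[g0 glow] rE alphaE betaE rg]]] := vert _ e20.
have [n0 betan0] : exists n0, forall i, (n0 <= i)%N -> (0 < m)%N ->
    `|beta i m.-1| <= e / 2.
  have [->|m0] := posnP m; first by exists 0%N.
  have [n0 n0P] := beta0 m0 _ e20; exists n0 => i /n0P.
  by rewrite subr0 => /ltW.
have lamb' : normc lam1^* = b by rewrite normcJ.
have [n [u [ru [u0 us ruE ruu]]]] :=
  backward_shift_far (maxn N n0) ab b0 lamb' e0.
pose y := tensor u g.
exists n, y; split.
- exact: tensor_neq0.
- move=> [i j]; rewrite tensorE mulf_eq0 negb_or /= => /andP[/us/andP[Ni ->] _].
  by rewrite andbT (leq_trans (leq_maxl _ _) Ni).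
- apply: adjoint_pair_bound adj1 _.
  have -> : S1 y - lam1^* *: y = tensor ru g.
    apply: ell2P => -[i j]; rewrite !ell2E (adjoint_shift_coord _ _ sh1 adj1).
    rewrite !tensorE /= ruE; have [->|gj] := eqVneq (g j) 0.
      by rewrite !mulr0 subrr.
    by rewrite alphaE//; ring.
  rewrite !ell2_norm_tensor mulrA ler_wpM2r ?ell2_norm_ge0//.
- apply: adjoint_pair_bound adj2 _.
  pose z := S2 y - lam2^* *: y - tensor u r.
  have -> : S2 y - lam2^* *: y = tensor u r + z by rewrite [RHS]addrC /z subrK.
  apply: le_trans (ell2_normD _ _) _.
  have zy : ell2_norm z <= e / 2 * ell2_norm y.
    apply: (@ell2_norm_pullback _ _ _ step2); [exact: ltW|exact: step2_inj|].
    move=> [i j]; rewrite !ell2E (adjoint_shift_coord _ _ sh2 adj2) !tensorE /=.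
    have rhs0 : 0 <= e / 2 * normc (u i * g j.+1).
      by rewrite mulr_ge0 ?normc_ge0 ?ltW.
    have [mj|jm] := leqP m j.
      have -> : (beta i j)%:C * (u i * g j.+1) = (w j)%:C * (u i * g j.+1).
        by have [->|gj] := eqVneq (g j.+1) 0; [rewrite !mulr0|rewrite betaE].
      rewrite rE//; set x := (X in normc X).
      by have -> : x = 0; [rewrite /x; ring | rewrite normc0].
    have [gj rj] := glow j jm; rewrite gj rj !mulr0 !subr0.
    have [jm1|jm1] := leqP m j.+1; last first.
      by have [-> _] := glow _ jm1; rewrite !mulr0 normc0 mulr0.
    have {jm1 jm} mE : m = j.+1 by apply/eqP; rewrite eqn_leq jm1.
    have [->|ui] := eqVneq (u i) 0; first by rewrite !(mul0r, mulr0) normc0 mulr0.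
    rewrite normcM normc_realE ler_wpM2r ?normc_ge0//.
    have := betan0 i; rewrite mE; apply=> //.
    by have /andP[+ _] := us _ ui; apply: leq_trans; rewrite leq_maxr.
  apply: le_trans (lerD (lexx _) zy) _.
  rewrite !ell2_norm_tensor.
  have := ler_wpM2l (ell2_norm_ge0 u) rg; lra.
Qed.

Lemma almost_orthogonal_far_up (c : R) (k : nat) :
    tends_to w c -> 0 < c -> normc lam2 = c ->
    (forall i j, (k <= j)%N -> alpha i j = 1) ->
    (forall i j, (k <= j)%N -> beta i j = w j) ->
    (forall e, 0 < e -> exists u r : ell2_type R nat, [/\ u != 0,
      forall i, r i = u i.+1 - lam1^* * u i &
      ell2_norm r <= e * ell2_norm u]) ->
  forall e N, 0 < e -> exists n y,
    almost_orthogonal snd (sub_scalar T1 lam1) (sub_scalar T2 lam2) e N n y.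
Proof.
move=> wc c0 lamc alpha1 betaw horiz e N e0.
have [u [r [u0 rE ru]]] := horiz _ e0.
have lamc' : normc lam2^* = c by rewrite normcJ.
have [n [g [rg [g0 gs rgE rgg]]]] :=
  backward_shift_far (maxn N k.+1) wc c0 lamc' e0.
have gk j : g j != 0 -> (k < j)%N.
  by move=> /gs/andP[+ _]; apply: leq_trans; rewrite leq_maxr.
pose y := tensor u g.
exists n, y; split.
- exact: tensor_neq0.
- move=> [i j]; rewrite tensorE mulf_eq0 negb_or /= => /andP[_ /gs/andP[Ni ->]].
  by rewrite andbT (leq_trans (leq_maxl _ _) Ni).
- apply: adjoint_pair_bound adj1 _.
  have -> : S1 y - lam1^* *: y = tensor r g.
    apply: ell2P => -[i j]; rewrite !ell2E (adjoint_shift_coord _ _ sh1 adj1).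
    rewrite !tensorE /= rE; have [->|/gk kj] := eqVneq (g j) 0.
      by rewrite !mulr0 subrr.
    by rewrite alpha1 ?(ltnW kj)//; ring.
  rewrite !ell2_norm_tensor mulrA ler_wpM2r ?ell2_norm_ge0//.
- apply: adjoint_pair_bound adj2 _.
  have -> : S2 y - lam2^* *: y = tensor u rg.
    apply: ell2P => -[i j]; rewrite !ell2E (adjoint_shift_coord _ _ sh2 adj2).
    rewrite !tensorE /= rgE; have [->|/gk kj] := eqVneq (g j.+1) 0.
      by rewrite !mulr0 !sub0r; ring.
    by rewrite betaw//; ring.
  rewrite !ell2_norm_tensor; have := ler_wpM2l (ell2_norm_ge0 u) rgg; lra.
Qed.
End JointApproximateEigenvectors.

(** * The spectral regions *)

Section GrowthObstruction.
Variable R : realType.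

(** Because |x_n| <= t^d |x_(n+d)| <= t^d M for all d. *)
Lemma backward_contraction_eq0 (x : nat -> R[i]) (M t : R) n0 : 0 <= t < 1 ->
    (forall n, normc (x n) <= M) ->
    (forall n, (n0 <= n)%N -> normc (x n) <= t * normc (x n.+1)) ->
  forall n, (n0 <= n)%N -> x n = 0.
Proof.
move=> t01 xM xt n n0n; have /andP[t0 _] := t01.
have bound d m : (n0 <= m)%N -> normc (x m) <= t ^+ d * M.
  elim: d m => [|d IH] m n0m; first by rewrite expr0 mul1r.
  apply: le_trans (xt _ n0m) _; rewrite exprS -mulrA ler_wpM2l// IH//.
  exact: leqW.
have M0 : 0 <= M := le_trans (normc_ge0 _) (xM 0%N).
apply/eqP; rewrite -normc_eq0 eq_le normc_ge0 andbT.
apply/ler_addgt0Pr => e e0; rewrite add0r.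
have M1 : 0 < M + 1 by rewrite ltr_wpDl.
have [|d /(_ d (leqnn d))] := @expr_lt_small _ t (e / (M + 1)) t01.
  by rewrite divr_gt0.
rewrite ltr_pdivlMr// => td; apply: le_trans (bound d n n0n) _.
by apply: le_trans (ltW td); rewrite ler_wpM2l ?exprn_ge0// lerDl.
Qed.

(** The equations say that x is, up to a nonzero factor, a preimage of the first
    basis vector under the weighted shift minus mu; for mu in the open disk such
    an x eventually grows geometrically. *)
Lemma shift_preimage_unbounded (v : nat -> R) (b M : R) (mu : R[i])
    (x : nat -> R[i]) :
    tends_to v b -> (forall i, 0 < v i) -> normc mu < b ->
    (forall n, normc (x n) <= M) -> mu * x 0%N != 0 ->
  ~ (forall i, (v i)%:C * x i = mu * x i.+1).
Proof.
move=> vb v0 mub xM; rewrite mulf_eq0 negb_or => /andP[mu0 x0] xE.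
have xn0 n : x n != 0.
  elim: n => // n IH; suff: mu * x n.+1 != 0 by rewrite mulf_eq0 negb_or => /andP[].
  by rewrite -xE mulf_neq0// fmorph_eq0 gt_eqF.
pose q := (normc mu + b) / 2.
have q0 : 0 < q by rewrite /q; have := normc_ge0 mu; lra.
have muq : normc mu < q by rewrite /q; lra.
have [|n0 vn0] := vb (b - q); first by rewrite /q; lra.
suff : x n0 = 0 by apply/eqP.
apply: (@backward_contraction_eq0 x M (normc mu / q) n0) => //.
  by rewrite divr_ge0 ?normc_ge0 ?(ltW q0)//= ltr_pdivrMr// mul1r.
move=> n n0n; have := vn0 n n0n; rewrite ltr_norml => /andP[qv _].
have {}qv : q <= v n by lra.
have := congr1 (@normc R) (xE n); rewrite !normcM normc_realE gtr0_norm// => E.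
by rewrite mulrAC ler_pdivlMr// -E mulrC ler_wpM2r ?normc_ge0.
Qed.
End GrowthObstruction.

(** The features of the diagram that decide the regions: horizontal weights at
    least 1, with limit b j > 1 in each of the first k rows and equal to 1 in
    the others, and vertical weights that tend to 0 along each row above which b
    drops. *)
Section Regions.
Variable R : realType.
Notation V := (ell2_type R (nat * nat)%type).
Variables (k : nat) (alpha beta : nat -> nat -> R) (w b : nat -> R) (c : R).
Variables (T1 T2 : {linear V -> V}) (S1 S2 : V -> V).
Hypothesis k0 : (0 < k)%N.
Hypothesis sh1 : index_shift step1 (fun p => alpha p.1 p.2) T1.
Hypothesis sh2 : index_shift step2 (fun p => beta p.1 p.2) T2.
Hypothesis adj1 : adjoint_pair T1 S1.
Hypothesis adj2 : adjoint_pair T2 S2.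
Hypothesis comm : forall u, T1 (T2 u) = T2 (T1 u).
Hypothesis alpha_ge1 : forall i j, 1 <= alpha i j.
Hypothesis beta_gt0 : forall i j, 0 < beta i j.
Hypothesis alpha_high : forall i j, (k <= j)%N -> alpha i j = 1.
Hypothesis beta_high : forall i j, (k <= j)%N -> beta i j = w j.
Hypothesis beta_column0 : forall j, beta 0 j = w j.
Hypothesis alpha_le : forall i j, (j < k)%N -> alpha i j <= b j.
Hypothesis alpha_lim : forall j, (j < k)%N -> tends_to (alpha^~ j) (b j).
Hypothesis b_gt1 : forall j, (j < k)%N -> 1 < b j.
Hypothesis b_noninc : forall j, (j.+1 < k)%N -> b j.+1 <= b j.
Hypothesis w_lt : forall j, w j < c.
Hypothesis w_lim : tends_to w c.
Hypothesis beta_decay_top : tends_to (beta^~ k.-1) 0.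
Hypothesis beta_decay :
  forall j, (j.+1 < k)%N -> b j.+1 < b j -> tends_to (beta^~ j) 0.

Let w_gt0 j : 0 < w j. Proof. by rewrite -beta_column0. Qed.
Let c_gt0 : 0 < c. Proof. exact: lt_trans (w_gt0 0) (w_lt 0). Qed.
Let alpha_gt0 i j : 0 < alpha i j. Proof. exact: lt_le_trans ltr01 (alpha_ge1 i j). Qed.

Let b_le0 j : (j < k)%N -> b j <= b 0%N.
Proof.
elim: j => // j IH jk; apply: le_trans (b_noninc jk) _.
by apply: IH; exact: ltnW.
Qed.

Variables lam1 lam2 : R[i].
Notation A1 := (sub_scalar T1 lam1).
Notation A2 := (sub_scalar T2 lam2).

Let lin1 a x y : A1 (a *: x + y) = a *: A1 x + A1 y.
Proof. by rewrite /sub_scalar linearP; apply: ell2P => i; rewrite !ell2E; ring. Qed.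
Let lin2 a x y : A2 (a *: x + y) = a *: A2 x + A2 y.
Proof. by rewrite /sub_scalar linearP; apply: ell2P => i; rewrite !ell2E; ring. Qed.
Let A1B x y : A1 (x - y) = A1 x - A1 y.
Proof. by rewrite addrC -scaleN1r lin1 scaleN1r addrC. Qed.
Let A2B x y : A2 (x - y) = A2 x - A2 y.
Proof. by rewrite addrC -scaleN1r lin2 scaleN1r addrC. Qed.
Let A10 : A1 0 = 0.
Proof. by have := lin1 (- 1) 0 0; rewrite scaler0 addr0 scaleN1r addNr. Qed.
Let A1Z a x : A1 (a *: x) = a *: A1 x.
Proof. by rewrite -[a *: x]addr0 lin1 A10 addr0. Qed.
Let A1D x y : A1 (x + y) = A1 x + A1 y.
Proof. by rewrite -[x in LHS]scale1r lin1 scale1r. Qed.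
Let A2D x y : A2 (x + y) = A2 x + A2 y.
Proof. by rewrite -[x in LHS]scale1r lin2 scale1r. Qed.
Let A20 : A2 0 = 0.
Proof. by have := lin2 (- 1) 0 0; rewrite scaler0 addr0 scaleN1r addNr. Qed.
Let A2N x : A2 (- x) = - A2 x.
Proof. by rewrite -sub0r A2B A20 sub0r. Qed.
Let commA x : A1 (A2 x) = A2 (A1 x).
Proof.
rewrite /sub_scalar !linearB !linearZ /= comm.
by apply: ell2P => i; rewrite !ell2E; ring.
Qed.
Let T2B x y : T2 (x - y) = T2 x - T2 y. Proof. exact: linearB. Qed.
Let T2Z a x : T2 (a *: x) = a *: T2 x. Proof. exact: linearZ. Qed.
Let comm2 x : A1 (T2 x) = T2 (A1 x).
Proof. by rewrite /sub_scalar T2B T2Z comm. Qed.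

Let inj1 x : A1 x = 0 -> x = 0.
Proof. exact: (index_shift_inj sh1 (rank := fst)). Qed.
Let inj2 x : A2 x = 0 -> x = 0.
Proof. exact: (index_shift_inj sh2 (rank := snd)). Qed.

Let sub_range1 : vsubspace (range A1).
Proof.
split; first by exists 0.
by move=> a _ _ [x _ <-] [y _ <-]; exists (a *: x + y).
Qed.

Let T1_coord x i j : T1 x (i.+1, j) = (alpha i j)%:C * x (i, j).
Proof. exact: (index_shift_coord sh1 x (i, j)). Qed.
Let T1_coord0 x j : T1 x (0%N, j) = 0.
Proof. by apply: (index_shift_coord0 sh1) => -[[i' j'] _]. Qed.
Let T2_coord x i j : T2 x (i, j.+1) = (beta i j)%:C * x (i, j).
Proof. exact: (index_shift_coord sh2 x (i, j)). Qed.
Let T2_coord0 x i : T2 x (i, 0%N) = 0.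
Proof. by apply: (index_shift_coord0 sh2) => -[[i' j'] _]. Qed.

Let high (m : nat) (x : V) := forall i j, (j < m)%N -> x (i, j) = 0.

Let highS m x : high m x -> high m.+1 (T2 x).
Proof.
move=> xm i [|j] jm; first exact: T2_coord0.
by rewrite T2_coord xm ?mulr0.
Qed.

(** Modulo the range of A2, a vector z equals (T2 / lam2) z, which lies one row
    higher. *)
Let push_up : lam2 != 0 ->
  forall m y, exists x z, y = A2 x + z /\ high m z.
Proof.
move=> l0 m y; elim: m => [|m [x [z [yE zm]]]].
  by exists 0, y; split=> //; rewrite /sub_scalar linear0 scaler0 subrr add0r.
exists (x - lam2^-1 *: z), (lam2^-1 *: T2 z); split.
  rewrite yE A2B -[RHS]addrA; congr (_ + _).
  by rewrite /sub_scalar T2Z scalerA mulfV// scale1r opprB subrK.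
by move=> i j jm; rewrite ell2E (highS zm) ?mulr0.
Qed.

Let high_range1 : 1 < normc lam1 -> forall z, high k z -> exists p, A1 p = z.
Proof.
move=> l1 z zk; have l0 : 0 < normc lam1 := lt_trans ltr01 l1.
apply: (index_shift_solve_forward (D := fun p => (k <= p.2)%N)
  (q := (normc lam1)^-1) sh1).
- by rewrite invr_ge0 normc_ge0/= invf_lt1.
- by rewrite -normc_eq0 gt_eqF.
- by [].
- by move=> [i j] /= kj; rewrite alpha_high// normr1 mulVf ?gt_eqF.
- by move=> [i j] /=; rewrite -ltnNge; exact: zk.
Qed.

(** After k steps up only weights below c < |lam2| remain. *)
Lemma exact_above : c < normc lam2 -> koszul_exact A1 A2.
Proof.
move=> cl; have l0 : 0 < normc lam2 := lt_trans c_gt0 cl.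
have l2 : lam2 != 0 by rewrite -normc_eq0 gt_eqF.
apply: koszul_exact_onto2 => // y.
have [x [z [-> zk]]] := push_up l2 k y.
have [||||p <-] := index_shift_solve_forward (D := fun p => (k <= p.2)%N)
  (q := c / normc lam2) (y := z) sh2 _ l2.
- by rewrite divr_ge0 ?(ltW c_gt0) ?normc_ge0//= ltr_pdivrMr// mul1r.
- by move=> [i j] /= kj; exact: leqW.
- by move=> [i j] /= kj; rewrite beta_high// gtr0_norm// divfK ?gt_eqF// ltW.
- by move=> [i j] /=; rewrite -ltnNge; exact: zk.
by exists (x + p); rewrite A2D.
Qed.

Lemma exact_beyond_rows : b 0%N < normc lam1 -> koszul_exact A1 A2.
Proof.
move=> bl; have b01 := b_gt1 k0.
have l0 : 0 < normc lam1 by apply: lt_trans bl; exact: lt_trans b01.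
apply: koszul_exact_onto1 => // y.
apply: (index_shift_solve_forward (D := xpredT) (q := b 0%N / normc lam1) sh1) => //.
- rewrite divr_ge0 ?normc_ge0 ?(ltW (lt_trans ltr01 b01))//=.
  by rewrite ltr_pdivrMr// mul1r.
- by rewrite -normc_eq0 gt_eqF.
- move=> [i j] _ /=; rewrite divfK ?gt_eqF// gtr0_norm//.
  have [kj|jk] := leqP k j; first by rewrite alpha_high// ltW.
  exact: le_trans (alpha_le _ jk) (b_le0 jk).
Qed.

(** T1 is an isometry of the rows from k on, so that for |lam1| > 1 they lie in
    the range of A1; both conditions for exactness can be tested there. *)
Lemma exact_right : 1 < normc lam1 -> lam2 != 0 -> koszul_exact A1 A2.
Proof.
move=> l1 l2; apply: koszul_exactI => // [x z xz|y]; last first.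
  have [x [z [-> /(high_range1 l1)[p <-]]]] := push_up l2 k y.
  by exists p, (- x); rewrite A2N opprK addrC.
(* modulo the range of A1, x equals (T2 / lam2)^m x, which moves up *)
have [xm [zm [u [xE [xmk _]]]]] : exists xm zm u,
    x = A1 zm + xm /\ high k xm /\ A2 xm = A1 u.
  elim: k => [|m [xm [zm [u [xE [xmm uE]]]]]].
    by exists x, 0, z; rewrite A10 add0r.
  exists (lam2^-1 *: T2 xm), (zm - lam2^-1 *: u), (lam2^-1 *: T2 u); split; [|split].
  - rewrite A1B A1Z -uE xE -[RHS]addrA; congr (_ + _).
    by rewrite /sub_scalar scalerBr scalerA mulVf// scale1r opprB subrK.
  - by move=> i j jm; rewrite ell2E (highS xmm) ?mulr0.
  - have -> : A2 (lam2^-1 *: T2 xm) = lam2^-1 *: T2 (A2 xm).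
      rewrite /sub_scalar T2Z T2B T2Z.
      by apply: ell2P => i; rewrite !ell2E; ring.
    by rewrite uE A1Z comm2.
have [p pE] := high_range1 l1 xmk.
by exists (zm + p); rewrite xE -pE A1D.
Qed.

(** Here T1 - lam1 is Fredholm by itself. It acts row by row: it is onto in the
    rows with b j < |lam1|, and in a row with |lam1| < b j the weights eventually
    dominate |lam1|, so that finitely many basis vectors complement the range. *)
Lemma fredholm_off_circles : 1 < normc lam1 ->
  (forall j, (j < k)%N -> normc lam1 != b j) -> koszul_fredholm A1 A2.
Proof.
move=> l1 lb; apply: koszul_fredholm_range1 => //.
have l0 : 0 < normc lam1 := lt_trans ltr01 l1.
have lam10 : lam1 != 0 by rewrite -normc_eq0 gt_eqF.
pose low n := [set y : V | forall i j, (n <= j)%N -> y (i, j) = 0].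
have rows n : (n <= k)%N -> spanned_mod (low n) (range A1).
  elim: n => [_|n IH nk].
    apply: sub_spanned_mod => y y0; exists 0 => //; rewrite A10.
    by apply: ell2P => -[i j]; rewrite y0.
  have {}IH := IH (ltnW nk).
  have [bn|bn|bn] := ltgtP (normc lam1) (b n);
    last by have := lb n nk; rewrite bn eqxx.
    pose m := (normc lam1 + b n) / 2.
    have lm : normc lam1 < m by rewrite /m; lra.
    have m0 : 0 < m := lt_trans l0 lm.
    have [|N NP] := alpha_lim nk (e := b n - m); first by rewrite /m; lra.
    pose Q N := [set y : V | forall i j, (n < j)%N \/ (n = j) /\ (N <= i)%N ->
      y (i, j) = 0].
    have QN d : spanned_mod (Q d) (range A1).
      elim: d => [|d IHd].
        apply: spanned_mod_sub IH => // y yQ i j.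
        rewrite leq_eqVlt => /orP[/eqP nj|nj]; apply: yQ; [by right|by left].
      apply: (spanned_mod_line (e := ell2_delta R (d, n))) IHd => y yQ.
      exists (y (d, n)) => // i j ij; rewrite !ell2E.
      have [[-> ->]|ne] := eqVneq (i, j) (d, n); first by rewrite ?eqxx mulr1 subrr.
      rewrite ?(negbTE ne) mulr0 subr0 yQ//; case: ij => [|[nj di]]; first by left.
      right; split=> //; rewrite ltn_neqAle di andbT; apply: contra ne => /eqP ->.
      by rewrite nj.
    apply: (spanned_mod_add sub_range1 _ (QN N.+1)) => y yl.
    have [|||p [r [yE rD rN]]] := index_shift_solve_backward
      (D := fun p => (p.2 == n) && (N <= p.1)%N)
      (q := normc lam1 / m) (m := m) (lam := lam1) sh1 y _ m0.
    - by rewrite divr_ge0 ?(ltW m0) ?(ltW l0)//= ltr_pdivrMr// mul1r.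
    - by rewrite divfK// gt_eqF.
    - move=> [i j] /= /andP[/eqP -> Ni].
      by have := NP i Ni; rewrite ltr_norml => /andP[+ _]; lra.
    exists (A1 p); first by exists p.
    have -> : y - A1 p = r by rewrite yE [X in X - _]addrC addrK.
    move=> i j [nj|[<- Ni]].
      rewrite rN ?yl//=; first by rewrite negb_and neq_ltn nj orbT.
      by move=> [i' j'] /= /andP[/eqP -> _] [_ jn]; rewrite jn ltnn in nj.
    by case: i Ni => // i Ni; apply: (rD (i, n)); rewrite /= eqxx.
  apply: (spanned_mod_add sub_range1 _ IH) => y yl.
  have [|||p [r [yE rD rN]]] := index_shift_restrict_forward
    (D := fun p => p.2 == n) (q := b n / normc lam1) y sh1 _ lam10.
  - rewrite divr_ge0 ?(ltW l0) ?(ltW (lt_trans ltr01 (b_gt1 nk)))//=.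
    by rewrite ltr_pdivrMr// mul1r.
  - by [].
  - by move=> [i j] /= /eqP ->; rewrite divfK ?gt_eqF// gtr0_norm ?alpha_le.
  exists (A1 p); first by exists p.
  have -> : y - A1 p = r by rewrite yE [X in X - _]addrC addrK.
  move=> i j.
  rewrite leq_eqVlt => /orP[/eqP nj|nj]; first by rewrite rD// nj.
  by rewrite rN ?yl//= neq_ltn nj orbT.
apply: (spanned_mod_add sub_range1 _ (rows k (leqnn k))) => y _.
have [|||p [r [yE rD rN]]] := index_shift_restrict_forward
  (D := fun p => (k <= p.2)%N) (q := (normc lam1)^-1) y sh1 _ lam10.
- by rewrite invr_ge0 normc_ge0/= invf_lt1.
- by [].
- by move=> [i j] /= kj; rewrite alpha_high// normr1 mulVf ?gt_eqF.
exists (A1 p); first by exists p.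
have -> : y - A1 p = r by rewrite yE [X in X - _]addrC addrK.
by move=> i j; exact: (rD (i, j)).
Qed.

Let column0 := [set y : V | forall i j, y (i.+1, j) = 0].

(** For |lam1| < 1 the 0-th column is a complement of the range of A1, on which
    T2 acts as the weighted shift with weights w. *)
Let column0_complement : normc lam1 < 1 ->
  forall y, exists p r, y = A1 p + r /\ column0 r.
Proof.
move=> l1 y.
have [|||p [r [yE rD _]]] := index_shift_solve_backward
  (D := xpredT) (q := normc lam1) (lam := lam1) sh1 y _ ltr01.
- by rewrite normc_ge0.
- by rewrite mulr1.
- by move=> [i j] _.
by exists p, r; split=> // i j; exact: (rD (i, j)).
Qed.

Let column0_range1 : normc lam1 < 1 -> forall p, column0 (A1 p) -> p = 0.
Proof.
move=> l1 p pc; apply: ell2P => -[i j]; rewrite ell2E.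
apply: (@backward_contraction_eq0 _ (fun i => p (i, j)) (ell2_norm p)
  (normc lam1) 0) => // [|n|n _].
- by rewrite normc_ge0.
- exact: ell2_norm_coord.
have := pc n j; rewrite /sub_scalar !ell2E T1_coord => /eqP.
rewrite subr_eq0 => /eqP/(congr1 (@normc R)); rewrite !normcM normc_realE => <-.
by rewrite ler_peMl ?normc_ge0// gtr0_norm.
Qed.

Let column0_A2 r : column0 r -> column0 (A2 r).
Proof.
move=> rc i j; rewrite /sub_scalar !ell2E rc mulr0 subr0.
by case: j => [|j]; rewrite ?T2_coord0// T2_coord rc mulr0.
Qed.

(** On the 0-th column, T2 - lam2 is a one-dimensional shift whose weights
    eventually dominate |lam2|. *)
Lemma fredholm_inside : normc lam1 < 1 -> normc lam2 < c ->
  koszul_fredholm A1 A2.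
Proof.
move=> l1 l2; apply: koszul_fredholmI => //.
  apply: sub_spanned_mod => x [z xz].
  have [p [r [xE rc]]] := column0_complement l1 x.
  have rE : A2 r = A1 (z - A2 p).
    by rewrite A1B commA -xz xE A2D addrC addKr.
  have /(column0_range1 l1) z0 : column0 (A1 (z - A2 p)).
    by rewrite -rE; exact: column0_A2.
  exists p => //; rewrite xE (inj2 (x := r)) ?addr0//.
  by rewrite rE z0 A10.
set B := range _.
have sB : vsubspace B.
  split; first by exists (0, 0) => //; rewrite /koszul1 /= A10 A20 subrr.
  move=> a _ _ [x _ <-] [y _ <-]; exists (a *: x + y) => //.
  by rewrite /koszul1 /= lin1 lin2 scalerBr opprD addrACA.
have B1 p : B (A1 p).
  by exists (0, p) => //; rewrite /koszul1 /= A20 subr0.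
have B2 p : B (A2 p).
  by exists (- p, 0) => //; rewrite /koszul1 /= A10 A2N sub0r opprK.
pose m := (normc lam2 + c) / 2.
have lm : normc lam2 < m by rewrite /m; lra.
have m0 : 0 < m by exact: le_lt_trans (normc_ge0 _) lm.
have [|N NP] := w_lim (e := c - m); first by rewrite /m; lra.
pose Q N := [set y : V | column0 y /\ forall j, (N <= j)%N -> y (0%N, j) = 0].
have QN d : spanned_mod (Q d) B.
  elim: d => [|d IHd].
    apply: sub_spanned_mod => y [yc y0]; have -> : y = 0; last by case: sB.
    by apply: ell2P => -[[|i] j]; rewrite ?yc ?y0.
  apply: (spanned_mod_line (e := ell2_delta R (0%N, d))) IHd => y [yc yQ].
  exists (y (0%N, d)) => //; split=> [i j|j dj]; rewrite !ell2E.
    by rewrite yc mulr0 subr0.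
  have [->|jd] := eqVneq j d; first by rewrite ?eqxx mulr1 subrr.
  rewrite xpair_eqE (negbTE jd) andbF mulr0 subr0 yQ//.
  by rewrite ltn_neqAle eq_sym jd.
have col : spanned_mod column0 B.
  apply: (spanned_mod_add sB _ (QN N.+1)) => y yc.
  have [|||p [r [yE rD rN]]] := index_shift_solve_backward
    (D := fun p => (p.1 == 0%N) && (N <= p.2)%N)
    (q := normc lam2 / m) (m := m) (lam := lam2) sh2 y _ m0.
  - by rewrite divr_ge0 ?(ltW m0) ?normc_ge0//= ltr_pdivrMr// mul1r.
  - by rewrite divfK// gt_eqF.
  - move=> [i j] /= /andP[/eqP -> Nj]; rewrite beta_column0.
    by have := NP j Nj; rewrite ltr_norml => /andP[+ _]; lra.
  exists (A2 p); first exact: B2.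
  have -> : y - A2 p = r by rewrite yE [X in X - _]addrC addrK.
  split=> [i j|[//|j] Nj].
    by rewrite rN ?yc//= => -[i' j'] /= /andP[/eqP -> _].
  exact: (rD (0%N, j)).
apply: (spanned_mod_add sB _ col) => y _.
have [p [r [yE rc]]] := column0_complement l1 y.
by exists (A1 p) => //; rewrite yE [X in X - _]addrC addrK.
Qed.

(** If A1 p - A2 q were the first basis vector, q could be taken in the 0-th
    column, where W - lam2 would reach that vector. *)
Lemma not_exact_inside : normc lam1 < 1 -> normc lam2 < c -> ~ koszul_exact A1 A2.
Proof.
move=> l1 l2 /koszul_exact_range/(_ (ell2_delta R (0%N, 0%N)))[p [q E]].
have [q' [r [qE rc]]] := column0_complement l1 q.
have rE : ell2_delta R (0%N, 0%N) + A2 r = A1 (p - A2 q').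
  rewrite A1B E commA qE A2D.
  by rewrite opprD [A1 p + _]addrA subrK.
have /(column0_range1 l1) z0 : column0 (A1 (p - A2 q')).
  rewrite -rE => i j; rewrite ell2DE (column0_A2 rc) addr0 ell2E.
  by [].
move: rE; rewrite z0 A10 => rE.
apply: (@shift_preimage_unbounded _ w c (ell2_norm r) lam2 (fun j => r (0%N, j))) => //.
- by move=> n; exact: ell2_norm_coord.
- have := congr1 (fun x : V => x (0%N, 0%N)) rE.
  rewrite /sub_scalar !ell2E T2_coord0 eqxx add0r => /eqP.
  by rewrite subr_eq0 => /eqP <-; exact: oner_neq0.
- move=> j; have := congr1 (fun x : V => x (0%N, j.+1)) rE.
  rewrite /sub_scalar !ell2E T2_coord add0r => /eqP.
  by rewrite subr_eq0 beta_column0 => /eqP.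
Qed.

(** For lam2 = 0 nothing in the 0-th row comes from T2. *)
Lemma not_exact_row0 : normc lam1 < b 0%N -> lam2 = 0 -> ~ koszul_exact A1 A2.
Proof.
move=> l1 l2 /koszul_exact_range/(_ (ell2_delta R (0%N, 0%N)))[p [q E]].
apply: (@shift_preimage_unbounded _ (alpha^~ 0%N) (b 0%N) (ell2_norm p) lam1
  (fun i => p (i, 0%N))) => //.
- exact: alpha_lim.
- by move=> n; exact: ell2_norm_coord.
- have := congr1 (fun x : V => x (0%N, 0%N)) E.
  rewrite /sub_scalar !ell2E l2 T2_coord0 T1_coord0 eqxx mul0r !subr0 sub0r => pE.
  by rewrite -oppr_eq0 -pE; exact: oner_neq0.
- move=> i; have := congr1 (fun x : V => x (i.+1, 0%N)) E.
  rewrite /sub_scalar !ell2E l2 T2_coord0 T1_coord mul0r !subr0 => /esym/eqP.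
  by rewrite subr_eq0 => /eqP.
Qed.

Let unweighted_tends_to : tends_to (fun=> 1 : R) 1.
Proof. by move=> e e0; exists 0%N => m _; rewrite subrr normr0. Qed.

Lemma not_fredholm_top : normc lam1 <= 1 -> normc lam2 = c -> ~ koszul_fredholm A1 A2.
Proof.
move=> l1 l2; apply: (@almost_orthogonal_not_fredholm _ _ snd) => e N e0.
apply: (almost_orthogonal_far_up sh1 sh2 adj1 adj2 w_lim c_gt0 l2
  alpha_high beta_high) => // {e0}e e0.
have l1' : normc lam1^* <= 1 by rewrite normcJ.
move: l1'; rewrite le_eqVlt => /orP[/eqP l1'|l1'].
  have [n [u [r [u0 _ rE ru]]]] :=
    backward_shift_far 0 unweighted_tends_to ltr01 l1' e0.
  by exists u, r; split=> // i; rewrite rE mul1r.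
have [u [r [u0 _ rE _ ru]]] :=
  backward_shift_eigen 0 unweighted_tends_to (fun=> ltr01) l1' e0.
by exists u, r; split=> // i; rewrite rE ?mul1r.
Qed.

Lemma not_fredholm_side : normc lam1 = 1 -> normc lam2 <= c -> ~ koszul_fredholm A1 A2.
Proof.
move=> l1; rewrite le_eqVlt => /orP[/eqP|] l2.
  by apply: not_fredholm_top => //; rewrite l1.
apply: (@almost_orthogonal_not_fredholm _ _ fst).
apply: (almost_orthogonal_far_right (w := w) (m := k) sh1 sh2 adj1 adj2
  unweighted_tends_to ltr01 l1) => // e e0.
have l2' : normc lam2^* < c by rewrite normcJ.
have [g [r [g0 glow rE _ rg]]] := backward_shift_eigen k w_lim w_gt0 l2' e0.
exists g, r; split=> // [i j gj|i j kj _]; last exact: beta_high.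
by apply: alpha_high; rewrite leqNgt; apply: contra gj => /glow[-> _].
Qed.

(** The lowest row with b j = |lam1| is the one to use: below it b is larger, so
    the vertical weights entering that row tend to 0. *)
Lemma not_fredholm_circle j : (j < k)%N -> normc lam1 = b j -> lam2 = 0 ->
  ~ koszul_fredholm A1 A2.
Proof.
move=> jk0 l1 l2.
have [j1 /andP[j1k /eqP lj1] j1min] :=
  @ex_minnP (fun j => (j < k)%N && (normc lam1 == b j))
    (ex_intro _ j (introT andP (conj jk0 (introT eqP l1)))).
apply: (@almost_orthogonal_not_fredholm _ _ fst).
apply: (almost_orthogonal_far_right (w := w) (m := j1) sh1 sh2 adj1 adj2
  (alpha_lim j1k) _ lj1) => [||e e0].
- exact: lt_trans (b_gt1 j1k).
- case: j1 j1k lj1 j1min => // j1 j1k lj1 j1min _; apply: beta_decay => //.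
  rewrite lt_neqAle b_noninc// andbT; apply/eqP => bE.
  by have := j1min j1; rewrite (ltnW j1k) lj1 bE eqxx ltnn => /(_ isT).
have l2' : normc lam2^* < c by rewrite normcJ l2 normc0.
have [g [r [g0 glow rE g1 rg]]] := backward_shift_eigen j1 w_lim w_gt0 l2' e0.
have {}g1 := g1 ltac:(by rewrite l2 conjC0).
exists g, r; split=> // [i j' /g1 -> //|i j' jj' /g1 jE].
by move: jj'; rewrite -jE ltnn.
Qed.

Lemma koszul_fredholm_iff : koszul_fredholm A1 A2 <->
  ~ [\/ normc lam1 <= 1 /\ normc lam2 = c,
        normc lam1 = 1 /\ normc lam2 <= c |
        (exists2 j, (j < k)%N & normc lam1 = b j) /\ lam2 = 0].
Proof.
split=> [fr [[l1 l2]|[l1 l2]|[[j jk l1] l2]]|out].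
- exact: not_fredholm_top fr.
- exact: not_fredholm_side fr.
- exact: not_fredholm_circle jk l1 l2 fr.
have [l1|l1|l1] := ltgtP (normc lam1) 1.
- have [l2|l2|l2] := ltgtP (normc lam2) c.
  + exact: fredholm_inside.
  + by apply: koszul_exact_fredholm => //; exact: exact_above.
  + by exfalso; apply: out; apply: Or31; rewrite ltW.
- have [l2|l2] := eqVneq lam2 0; last first.
    by apply: koszul_exact_fredholm => //; exact: exact_right.
  apply: fredholm_off_circles => // j jk; apply/eqP => lb.
  by apply: out; apply: Or33; split=> //; exists j.
- have [l2|l2] := leP (normc lam2) c; last first.
    by apply: koszul_exact_fredholm => //; exact: exact_above.
  by exfalso; apply: out; apply: Or32.
Qed.

Lemma koszul_exact_iff : koszul_exact A1 A2 <->
  ~ ((normc lam1 <= 1 /\ normc lam2 <= c) \/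
     (normc lam1 <= b 0%N /\ lam2 = 0)).
Proof.
split=> [ex|out].
  have /koszul_fredholm_iff fr : koszul_fredholm A1 A2.
    exact: koszul_exact_fredholm.
  case=> -[l1 l2].
    move: l1 l2; rewrite le_eqVlt => /orP[/eqP l1 l2|l1].
      by apply: fr; apply: Or32.
    rewrite le_eqVlt => /orP[/eqP l2|l2]; last exact: not_exact_inside ex.
    by apply: fr; apply: Or31; rewrite ltW.
  move: l1; rewrite le_eqVlt => /orP[/eqP l1|l1]; last exact: not_exact_row0 ex.
  by apply: fr; apply: Or33; split=> //; exists 0%N.
have [l1|l1] := leP (normc lam1) 1.
  apply: exact_above; rewrite ltNge; apply/negP => l2.
  by apply: out; left.
have [l2|l2] := eqVneq lam2 0; last exact: exact_right.
apply: exact_beyond_rows; rewrite ltNge; apply/negP => l1'.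
by apply: out; right.
Qed.
End Regions.

(** * Bergman weights and boundedness of the vertical weights *)

Section ShiftWeights.
Variable R : realType.

Lemma bergman_weight_sqr (l n : nat) : (1 <= l)%N ->
  bergman_weight R l n ^+ 2 = l%:R - n.+2%:R^-1.
Proof.
move=> l1; rewrite sqr_sqrtr// subr_ge0.
by rewrite (@le_trans _ _ 1)// ?ler1n// invf_le1// ler1n.
Qed.

Lemma bergman_weight_le (l n : nat) : bergman_weight R l n <= Num.sqrt l%:R.
Proof. by rewrite ler_wsqrtr// gerBl invr_ge0. Qed.

Lemma invn_small (e : R) : 0 < e ->
  exists n, forall m, (n <= m)%N -> (m.+2%:R : R)^-1 < e.
Proof.
move=> e0; exists (Num.trunc e^-1) => m nm.
rewrite -[e]invrK ltf_pV2 ?posrE ?invr_gt0//.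
by apply: lt_le_trans (truncnS_gt _) _; rewrite ler_nat ltnS; apply: leq_trans nm _.
Qed.

Lemma bergman_weight_lim (l : nat) : (1 <= l)%N ->
  tends_to (bergman_weight R l) (Num.sqrt l%:R).
Proof.
move=> l1 e e0; have [n nP] := invn_small e0; exists n => m /nP me.
rewrite distrC ger0_norm ?subr_ge0 ?bergman_weight_le//.
apply: le_lt_trans me; set s := m.+2%:R^-1.
have s0 : 0 <= s by rewrite invr_ge0.
have s1 : s <= 1 by rewrite invf_le1// ler1n.
have r1 : 1 <= Num.sqrt (l%:R : R) by rewrite -{1}sqrtr1 ler_wsqrtr// ler1n.
have r2 : Num.sqrt (l%:R : R) ^+ 2 = l%:R by rewrite sqr_sqrtr.
rewrite lerBlDr -lerBlDl -ler_sqr ?nnegrE; last 2 first.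
- by rewrite subr_ge0 (le_trans s1).
- exact: sqrtr_ge0.
rewrite bergman_weight_sqr// -/s; nra.
Qed.

Section RowRatios.
(* x is a row of vertical weights, leading from the horizontal weights a to the
   horizontal weights a' *)
Variables x a a' : nat -> R.
Hypothesis x0 : forall i, 0 < x i.
Hypothesis a0 : forall i, 0 < a i.
Hypothesis xa : forall i, x i.+1 * a i = a' i * x i.

Lemma row_ratio_growth (q M : R) : 1 < q -> (forall i, q * a i <= a' i) ->
  ~ (forall i, x i <= M).
Proof.
move=> q1 qa xM; have q0 : 0 < q := lt_trans ltr01 q1.
have step i : q * x i <= x i.+1.
  rewrite -(ler_pM2r (a0 i)) xa mulrAC ler_pM2r//.
have bound i : x 0%N <= q^-1 ^+ i * x i.
  elim: i => [|i IH]; first by rewrite expr0 mul1r.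
  apply: le_trans IH _; rewrite exprSr -mulrA ler_wpM2l ?exprn_ge0 ?invr_ge0 ?(ltW q0)//.
  by rewrite mulrC ler_pdivlMr// mulrC.
have M0 : 0 < M := lt_le_trans (x0 0) (xM 0%N).
have [||i /(_ i (leqnn i))] := @expr_lt_small _ q^-1 (x 0%N / M).
- by rewrite invr_ge0 (ltW q0)/= invf_lt1.
- by rewrite divr_gt0.
rewrite ltr_pdivlMr//; apply/negP; rewrite -leNgt.
apply: le_trans (bound i) _.
by rewrite ler_wpM2l ?exprn_ge0 ?invr_ge0 ?(ltW q0).
Qed.

Lemma row_ratio_decay (q : R) : 0 <= q < 1 -> (forall i, a' i <= q * a i) ->
  tends_to x 0.
Proof.
move=> q01 qa; apply: (@ratio_tends_to0 _ x q 0) => // [n|n _]; first exact: ltW.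
by rewrite -(ler_pM2r (a0 n)) xa mulrAC ler_pM2r.
Qed.
End RowRatios.

Lemma bergman_weight_growth (l l' i : nat) : (1 <= l)%N -> (l < l')%N ->
  Num.sqrt (1 + l%:R^-1) * bergman_weight R l i <= bergman_weight R l' i.
Proof.
move=> l1 ll'; have l0 : 0 < l%:R :> R by rewrite ltr0n.
have l'1 : (1 <= l')%N := leq_trans l1 (ltnW ll').
rewrite -ler_sqr ?nnegrE ?mulr_ge0 ?sqrtr_ge0//.
rewrite exprMn !bergman_weight_sqr// sqr_sqrtr ?addr_ge0 ?invr_ge0 ?(ltW l0)//.
set s := i.+2%:R^-1; have s0 : 0 <= s by rewrite invr_ge0.
have ll'R : l%:R + 1 <= l'%:R :> R by rewrite natr1 ler_nat.
rewrite mulrDl mul1r mulrBr mulVf ?gt_eqF//.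
have : 0 <= l%:R^-1 * s by rewrite mulr_ge0 ?invr_ge0 ?(ltW l0).
lra.
Qed.

Lemma bergman_weight_decay (l l' i : nat) : (1 <= l')%N -> (l' < l)%N ->
  bergman_weight R l' i <= Num.sqrt (l'%:R / l%:R) * bergman_weight R l i.
Proof.
move=> l'1 ll'; have l1 : (1 <= l)%N := leq_trans l'1 (ltnW ll').
have l0 : 0 < l%:R :> R by rewrite ltr0n.
rewrite -ler_sqr ?nnegrE ?mulr_ge0 ?sqrtr_ge0//.
rewrite exprMn !bergman_weight_sqr// sqr_sqrtr ?divr_ge0//.
set s := i.+2%:R^-1; have s0 : 0 <= s by rewrite invr_ge0.
rewrite mulrBr divfK ?gt_eqF// lerB// ler_piMl//.
by rewrite ler_pdivrMr// mul1r ler_nat ltnW.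
Qed.

(** For l = 1 the products telescope: under an unweighted row, commutation gives
    x i ^+ 2 = (i + 1) * x 0 ^+ 2. *)
Lemma bergman_weight1_growth (x : nat -> R) (M : R) : (forall i, 0 < x i) ->
    (forall i, x i.+1 * bergman_weight R 1 i = x i) ->
  ~ (forall i, x i <= M).
Proof.
move=> x0 xa xM.
have xsq i : x i ^+ 2 = x 0%N ^+ 2 * i.+1%:R.
  elim: i => [|i IH]; first by rewrite mulr1.
  have := congr1 (fun z => z ^+ 2) (xa i); rewrite /= exprMn bergman_weight_sqr// IH.
  have i2 : i.+2%:R != 0 :> R by rewrite pnatr_eq0.
  have -> : 1 - i.+2%:R^-1 = i.+1%:R / i.+2%:R :> R.
    by rewrite -[i.+1%:R](addrK 1) natr1 mulrBl divff// mul1r.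
  have i1 : i.+1%:R != 0 :> R by rewrite pnatr_eq0.
  move=> E; apply: (mulIf i1); rewrite [RHS]mulrAC -E mulrA divfK//.
have x20 : 0 < x 0%N ^+ 2 by rewrite exprn_gt0.
have := xsq (Num.trunc (M ^+ 2 / x 0%N ^+ 2)).
set i := Num.trunc _ => xi.
have := truncnS_gt (M ^+ 2 / x 0%N ^+ 2); rewrite -/i ltr_pdivrMr// mulrC -xi.
have xi0 : 0 <= x i by exact: ltW.
by rewrite ltr_sqr ?nnegrE ?(le_trans xi0 (xM i))// ltNge xM.
Qed.
End ShiftWeights.

(** * The two spectra *)

Section DiskMembership.
Variables (R : realType) (r : R).
Hypothesis r0 : 0 < r.
Implicit Type z : R[i].

Lemma closed_diskE z : closed_disk z = (normc z <= 1) :> Prop.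
Proof. by rewrite -lecR. Qed.

Lemma unit_circleE z : unit_circle z <-> normc z = 1.
Proof.
by split=> [/complexI //|z1]; rewrite /unit_circle /= norm_normc z1.
Qed.

Let rC : r%:C != 0 :> R[i]. Proof. by rewrite fmorph_eq0 gt_eqF. Qed.

Lemma dilate_diskE z : dilate r closed_disk z <-> normc z <= r.
Proof.
split=> [[y + <-]|zr].
  rewrite closed_diskE normcM normc_realE gtr0_norm// => y1.
  by rewrite -[leRHS]mulr1 ler_pM2l.
exists (z / r%:C); last by rewrite mulrC divfK.
by rewrite closed_diskE normcM normcV normc_realE gtr0_norm// ler_pdivrMr// mul1r.
Qed.

Lemma dilate_circleE z : dilate r unit_circle z <-> normc z = r.
Proof.
split=> [[y /unit_circleE y1 <-]|zr].
  by rewrite normcM y1 normc_realE gtr0_norm// mulr1.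
exists (z / r%:C); last by rewrite mulrC divfK.
by apply/unit_circleE; rewrite normcM normcV normc_realE gtr0_norm// zr divff ?gt_eqF.
Qed.
End DiskMembership.

Theorem theorem2p6 (R : realType) (k : nat) (l : nat -> nat)
  (w : nat -> R) (alpha beta : nat -> nat -> R)
  (B : nat -> {linear ell2 R nat -> ell2 R nat})
  (W : {linear ell2 R nat -> ell2 R nat})
  (T1 T2 : {linear ell2 R (nat * nat)%type -> ell2 R (nat * nat)%type})
  (hk : (1 <= k)%N)
  (hl : forall j, (j < k)%N -> (1 <= l j)%N)
  (hB : forall j, (j < k)%N -> weighted_shift (@bergman_weight R (l j)) (B j))
  (hW : weighted_shift w W)
  (hWsub : subnormal W)
  (hWincr : forall n, w n < w n.+1)
  (hT : weighted_shift2 alpha beta T1 T2)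
  (hcomm : forall u, T1 (T2 u) = T2 (T1 u))
  (hrow_lt : forall i j, (j < k)%N -> alpha i j = bergman_weight R (l j) i)
  (hrow_ge : forall i j, (k <= j)%N -> alpha i j = 1)
  (hcol : forall j, beta 0%N j = w j)
  (hhyp : hyponormal_pair T1 T2) :
  let b := fun j => opnorm (B j) in
  let c := opnorm W in
  taylor_spectrum T1 T2 =
    (closed_disk `*` dilate c closed_disk) `|`
    (dilate (b 0%N) closed_disk `*` [set 0]) /\
  taylor_essential_spectrum T1 T2 =
    (closed_disk `*` dilate c unit_circle) `|`
    (unit_circle `*` dilate c closed_disk) `|`
    ((\bigcup_(j in `I_k) dilate (b j) unit_circle) `*` [set 0]).
Proof.
move=> b c.
have [S1 [S2 [adj1 adj2 _]]] := hhyp.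
have alpha0 := ws2_weight1_gt0 hT; have beta0 := ws2_weight2_gt0 hT.
have sh1 : index_shift step1 (fun p => alpha p.1 p.2) T1.
  split; [exact: step1_inj|exact: bounded_operatorP (ws2_bounded1 hT)|].
  by move=> [i j]; exact: ws2_shift1 hT i j.
have sh2 : index_shift step2 (fun p => beta p.1 p.2) T2.
  split; [exact: step2_inj|exact: bounded_operatorP (ws2_bounded2 hT)|].
  by move=> [i j]; exact: ws2_shift2 hT i j.
have shW : index_shift S w W.
  by split; [exact: succn_inj|exact: bounded_operatorP hW.1|exact: hW.2].
have shB j : (j < k)%N -> index_shift S (bergman_weight R (l j)) (B j).
  move=> /hB[Bb Bs].
  by split; [exact: succn_inj|exact: bounded_operatorP|exact: Bs].
have ratio j i : beta i.+1 j * alpha i j = alpha i j.+1 * beta i j.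
  have := congr1 (fun x : ell2_type R (nat * nat)%type => x (i.+1, j.+1))
    (hcomm (ell2_basis R (i, j))).
  rewrite (index_shift_coord sh1 _ (i, j.+1)) (index_shift_coord sh2 _ (i.+1, j)).
  rewrite (index_shift_coord sh2 _ (i, j)) (index_shift_coord sh1 _ (i, j)) /=.
  by rewrite eqxx !mulr1 -!real_complexM => /complexI.
have [M betaM] := ws2_weight2_bounded hT.
(* boundedness of the vertical weights orders the first k rows *)
have top k' : k = k'.+1 -> (2 <= l k')%N.
  move=> kE; have k'k : (k' < k)%N by rewrite kE.
  have := hl k' k'k; rewrite leq_eqVlt => /orP[/eqP l1|//].
  exfalso; apply: (@bergman_weight1_growth _ (beta^~ k') M) => // i.
  by have := ratio k' i; rewrite hrow_lt// hrow_ge ?kE// mul1r -l1.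
have noninc j : (j.+1 < k)%N -> (l j.+1 <= l j)%N.
  move=> jk; have jk' := ltnW jk; have l1 := hl _ jk'.
  rewrite leqNgt; apply/negP => ll.
  apply: (@row_ratio_growth _ (beta^~ j) (alpha^~ j) (alpha^~ j.+1) _ _ _
    (Num.sqrt (1 + (l j)%:R^-1)) M) => // [|i].
    by rewrite -[ltLHS]sqrtr1 ltr_sqrt ?addr_gt0 ?invr_gt0 ?ltr0n// ltrDl invr_gt0 ltr0n.
  by rewrite !hrow_lt//; exact: bergman_weight_growth.
have l_ge2 j : (j < k)%N -> (2 <= l j)%N.
  have [k' kE] : exists k', k = k'.+1 by exists k.-1; rewrite prednK.
  rewrite kE ltnS => jk'.
  have : forall d, (d <= k')%N -> (2 <= l (k' - d))%N.
    elim=> [|d IH] dk; first by rewrite subn0; exact: top.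
    apply: leq_trans (IH (ltnW dk)) _.
    have -> : (k' - d = (k' - d.+1).+1)%N by lia.
    by apply: noninc; rewrite kE; lia.
  by move=> /(_ (k' - j)%N); rewrite subKn// leq_subr => /(_ isT).
have alpha_ge1 i j : 1 <= alpha i j.
  have [kj|jk] := leqP k j; first by rewrite hrow_ge.
  rewrite hrow_lt// -[leLHS]sqrtr1 ler_wsqrtr//.
  have : 2 <= (l j)%:R :> R by rewrite ler_nat l_ge2.
  have : (i.+2%:R : R)^-1 <= 1 by rewrite invf_le1// ler1n.
  by move: (i.+2%:R^-1) ((l j)%:R) => s L; lra.
have bE j : (j < k)%N -> b j = Num.sqrt (l j)%:R.
  move=> jk; apply: (opnorm_index_shift (shB j jk)); first exact: sqrtr_ge0.
    by move=> i; rewrite bergman_weight_le sqrtr_ge0.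
  move=> e /(bergman_weight_lim (hl j jk))[n /(_ n (leqnn n))].
  by rewrite ltr_norml => /andP[+ _]; exists n; lra.
have b_gt1 j : (j < k)%N -> 1 < b j.
  move=> jk; rewrite bE// -[ltLHS]sqrtr1 ltr_sqrt ?ltr0n ?ltr1n ?l_ge2//.
  exact: hl.
have [cE cw] : (forall j, w j < c) /\ tends_to w c.
  have [_ [N N0 WN] Wd] := shW.
  have w0 j : 0 < w j by rewrite -hcol.
  have wN j : w j <= N.
    have := WN (ell2_delta R j); rewrite Wd ell2_normZ !ell2_norm_delta !mulr1.
    by rewrite normc_realE gtr0_norm.
  have sw : has_sup (range w).
    by split; [exists (w 0%N), 0%N|exists N => _ [j _ <-]].
  have wsup j : w j <= sup (range w) by apply: ub_le_sup; [case: sw|exists j].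
  have supw e : 0 < e -> exists j, sup (range w) - e < w j.
    by move=> e0; have [_ [j _ <-] ?] := sup_adherent e0 sw; exists j.
  have -> : c = sup (range w).
    apply: (opnorm_index_shift shW) => // [|i]; last by rewrite wsup ltW.
    exact: le_trans (ltW (w0 0%N)) _.
  split=> [j|e e0]; first exact: lt_le_trans (hWincr j) _.
  have w_mono m n : (m <= n)%N -> w m <= w n.
    elim: n => [|n IH]; first by rewrite leqn0 => /eqP ->.
    by rewrite leq_eqVlt => /orP[/eqP ->//|/IH /le_trans]; apply; exact: ltW.
  have [j ej] := supw e e0; exists j => m /w_mono jm.
  by rewrite distrC ger0_norm ?subr_ge0 ?wsup//; lra.
have c_gt0 : 0 < c by apply: lt_trans (cE 0%N); rewrite -hcol.
have beta_high i j : (k <= j)%N -> beta i j = w j.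
  move=> kj; elim: i => // i IH; have := ratio j i.
  by rewrite !hrow_ge ?(leqW kj)// mulr1 mul1r IH.
have alpha_le i j : (j < k)%N -> alpha i j <= b j.
  by move=> jk; rewrite hrow_lt// bE//; exact: bergman_weight_le.
have alpha_lim j : (j < k)%N -> tends_to (alpha^~ j) (b j).
  move=> jk; have -> : alpha^~ j = bergman_weight R (l j).
    by apply/funext => i; rewrite hrow_lt.
  by rewrite bE//; apply: bergman_weight_lim; exact: hl.
have b_noninc j : (j.+1 < k)%N -> b j.+1 <= b j.
  by move=> jk; rewrite !bE ?(ltnW jk)// ler_wsqrtr// ler_nat noninc.
have beta_decay_top : tends_to (beta^~ k.-1) 0.
  have kk : (k.-1 < k)%N by rewrite prednK.
  apply: (@row_ratio_decay _ _ (alpha^~ k.-1) (alpha^~ k) _ _ _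
    (Num.sqrt (2 / 3))) => // [i||i].
  - by have := ratio k.-1 i; rewrite prednK.
  - by rewrite sqrtr_ge0 -[ltRHS]sqrtr1 ltr_sqrt//; lra.
  rewrite hrow_ge// hrow_lt// -ler_sqr ?nnegrE ?mulr_ge0 ?sqrtr_ge0//.
  rewrite exprMn bergman_weight_sqr ?hl// sqr_sqrtr ?expr1n; last by lra.
  have : 2 <= (l k.-1)%:R :> R by rewrite ler_nat l_ge2.
  have : (i.+2%:R : R)^-1 <= 2^-1 by rewrite lef_pV2 ?posrE// ler_nat.
  by move: (i.+2%:R^-1) ((l k.-1)%:R) => s L; lra.
have beta_decay j : (j.+1 < k)%N -> b j.+1 < b j -> tends_to (beta^~ j) 0.
  move=> jk; have jk' := ltnW jk; rewrite !bE// ltr_sqrt ?ltr0n ?hl// ltr_nat => ll.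
  apply: (@row_ratio_decay _ _ (alpha^~ j) (alpha^~ j.+1) _ _ _
    (Num.sqrt ((l j.+1)%:R / (l j)%:R))) => // [|i].
  - rewrite sqrtr_ge0 -[ltRHS]sqrtr1 ltr_sqrt//.
    by rewrite ltr_pdivrMr ?ltr0n ?hl// mul1r ltr_nat.
  - by rewrite !hrow_lt//; apply: bergman_weight_decay => //; exact: hl.
have b0_gt1 := b_gt1 _ hk.
have b0_gt0 := lt_trans ltr01 b0_gt1.
have exactE lam1 lam2 := koszul_exact_iff hk sh1 sh2 adj1 adj2 hcomm alpha_ge1
  beta0 hrow_ge beta_high hcol alpha_le alpha_lim b_gt1 b_noninc cE cw
  beta_decay_top beta_decay lam1 lam2.
have fredholmE lam1 lam2 := koszul_fredholm_iff sh1 sh2 adj1 adj2 hcomm alpha_ge1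
  beta0 hrow_ge beta_high hcol alpha_le alpha_lim b_gt1 b_noninc cE cw
  beta_decay_top beta_decay lam1 lam2.
split; apply/seteqP; split=> -[lam1 lam2].
- rewrite /taylor_spectrum /= exactE => /contrapT[[l1 l2]|[l1 l2]]; [left|right].
    by split; [rewrite closed_diskE|apply/dilate_diskE].
  by split=> //; apply/dilate_diskE.
- rewrite /taylor_spectrum /= exactE => H; apply; move: H.
  move=> [[/= + /(dilate_diskE c_gt0)]|[/= /(dilate_diskE b0_gt0)]]; [|by right].
  by rewrite closed_diskE; left.
- rewrite /taylor_essential_spectrum /= fredholmE => /contrapT.
  case=> [[l1 l2]|[l1 l2]|[[j jk l1] l2]].
  + left; left; split; first by rewrite /= closed_diskE.
    exact/dilate_circleE.
  + left; right; split; first exact/unit_circleE.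
    exact/dilate_diskE.
  + right; split=> //; exists j => //.
    by apply/dilate_circleE => //; exact: lt_trans ltr01 (b_gt1 j jk).
- rewrite /taylor_essential_spectrum /= fredholmE => H; apply; move: H.
  case=> [[[/=]|[/=]]|[/= [j jk]]].
  + by rewrite closed_diskE => l1 /(dilate_circleE c_gt0) l2; apply: Or31.
  + by move=> /unit_circleE l1 /(dilate_diskE c_gt0) l2; apply: Or32.
  + have bj0 := lt_trans ltr01 (b_gt1 j jk).
    by move=> /(dilate_circleE bj0) l1 l2; apply: Or33; split=> //; exists j.
Qed.
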